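(* The pMC verification problem is polynomial-time (many-one) reducible to the pMC monotonicity problem. Here the pMC verification problem is: given a pMC $\mathcal{M}=(S,s_I,T,V,\mathcal{P})$, a threshold $\lambda\in[0,1]$ and a graph-preserving region $R$, decide whether $\mathrm{sol}_{s_I}(\vec u)\ge \lambda$ for all $\vec u\in R$. The pMC monotonicity problem is: given a pMC $\mathcal{M}$, a parameter $p\in V$ and a graph-preserving region $R$, decide whether $\mathcal{M}$ is monotonic increasing in $p$ on $R$.
   Context: A parametric Markov chain (pMC) is a tuple $\mathcal{M}=(S,s_I,T,V,\mathcal{P})$ with a finite set of states $S$, an initial state $s_I\in S$, a set of target states $T\subseteq S$, a finite set $V$ of real-valued parameters, and a transition function $\mathcal{P}:S\times S\to\mathbb{Q}[V]$ (multivariate polynomials over $V$). An instantiation is a map $\vec u:V\to\mathbb{R}$; $\mathcal{M}[\vec u]$ is obtained by evaluating every polynomial at $\vec u$. The instantiation is well-defined if $\mathcal{M}[\vec u]$ is a Markov chain (each $\mathcal{P}(s,\cdot)(\vec u)$ is a probability distribution on $S$), and graph-preserving if it is well-defined and $\mathcal{P}(s,s')\neq 0$ implies $\mathcal{P}(s,s')(\vec u)\neq 0$ for all $s,s'$. A region is a set of instantiations; it is graph-preserving if all its elements are. The solution function $\mathrm{sol}_s$ maps $\vec u$ to the probability of eventually reaching $T$ from $s$ in the Markov chain $\mathcal{M}[\vec u]$. A function $f:\mathbb{R}^n\to\mathbb{R}$ is monotonic increasing in $x_i$ on $R$ if $f(\vec a)\le f(\vec a+b\vec e_i)$ for all $\vec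 a\in R$ and all $b\ge 0$ ($\vec e_i$ the $i$-th unit vector). $\mathcal{M}$ is monotonic increasing in $p$ on $R$ if $\mathrm{sol}_{s_I}$ is monotonic increasing in $p$ on $R$.
   Formalization: Regions are given by Boolean combinations of polynomial (in)equalities with rational coefficients and the threshold λ is rational, so that inputs are finite; monotonicity on R compares f(a) with f(a + b e_i) only when both points lie in R, since sol is undefined at ill-defined instantiations. *)

(* Defs.v *)
From HB Require Import structures.
From mathcomp Require Import all_boot all_order all_algebra.
From mathcomp Require Import all_classical all_reals all_analysis.
(* Not imported wholesale: its notations clash with those of all_analysis. *)
From mathcomp.multinomials Require mpoly.
Import (canonicals) mpoly.

Set Implicit Arguments.
Unset Strict Implicit.
Unset Printing Implicit Defensive.
Import Order.TTheory GRing.Theory Num.Theory.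
Local Open Scope ring_scope.
Local Open Scope classical_set_scope.

(* A two-way infinite tape: [None] is the blank, the lists hold the cells to the
   left (nearest first) and to the right of the head, blank beyond their end. *)
Record tape (A : Type) := Tape {
  tape_left : seq (option A);
  tape_cur : option A;
  tape_right : seq (option A) }.

Inductive move := MoveLeft | Stay | MoveRight.

Definition tape_move (A : Type) (d : move) (t : tape A) : tape A :=
  let: Tape l c r := t in
  match d with
  | MoveLeft => Tape (behead l) (head None l) (c :: r)
  | Stay => t
  | MoveRight => Tape (c :: l) (head None r) (behead r)
  end.

Definition tape_write (A : Type) (c : option A) (t : tape A) : tape A :=
  Tape (tape_left t) c (tape_right t).

Definition blank_tape (A : Type) : tape A := Tape [::] None [::].

Definition tape_of_word (A : Type) (w : seq A) : tape A :=
  Tape [::] (ohead w) (map Some (behead w)).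

Fixpoint until_blank (A : Type) (s : seq (option A)) : seq A :=
  if s is Some a :: s' then a :: until_blank s' else [::].

Definition word_of_tape (A : Type) (t : tape A) : seq A :=
  until_blank (tape_cur t :: tape_right t).

Record TM (A : finType) := MkTM {
  tm_tapes : nat; (* one less than the number of tapes *)
  tm_state : finType;
  tm_start : tm_state;
  tm_halt : pred tm_state;
  tm_delta : tm_state -> {ffun 'I_tm_tapes.+1 -> option A} ->
             tm_state * {ffun 'I_tm_tapes.+1 -> option A * move} }.

Section Run.
Variables (A : finType) (M : TM A).

Definition config : Type :=
  (tm_state M * {ffun 'I_(tm_tapes M).+1 -> tape A})%type.

(* Halting configurations are fixed points. *)
Definition tm_step (c : config) : config :=
  if tm_halt c.1 then c else
  let: (q, act) := tm_delta c.1 [ffun i => tape_cur (c.2 i)] in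
  (q, [ffun i => tape_move (act i).2 (tape_write (act i).1 (c.2 i))]).

Definition tm_init (w : seq A) : config :=
  (tm_start M, [ffun i => if i == ord0 then tape_of_word w else blank_tape A]).

(* The output is the blank-free word starting at the head of tape 0. *)
Definition tm_computes_in (w v : seq A) (t : nat) : Prop :=
  let c := iter t tm_step (tm_init w) in
  tm_halt c.1 /\ word_of_tape (c.2 ord0) = v.

End Run.

Definition polytime_computable (A : finType) (f : seq A -> seq A) : Prop :=
  exists (M : TM A) (p : {poly nat}),
    forall w : seq A, tm_computes_in M w (f w) p.[size w].

Record promise_problem (A : Type) := PromiseProblem {
  yes_instance : seq A -> Prop;
  no_instance : seq A -> Prop }.

Definition polytime_reducible (A : finType) (K L : promise_problem A) : Prop :=
  exists f : seq A -> seq A,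
    [/\ polytime_computable f,
        forall w, yes_instance K w -> yes_instance L (f w) &
        forall w, no_instance K w -> no_instance L (f w)].

Section MarkovChain.
Variables (R : realType) (n : nat).
Local Notation state := 'I_n.+1.

Definition path_space : Type := nat -> state.
HB.instance Definition _ := Choice.copy path_space (nat -> state).
HB.instance Definition _ := isPointed.Build path_space (fun=> ord0).

Definition cylinder (h : seq state) : set path_space :=
  [set w | mkseq w (size h) = h].

Definition cylinders : set (set path_space) := range cylinder.

Definition is_stochastic (Q : state -> state -> R) : Prop :=
  forall s, (forall s', 0 <= Q s s') /\ \sum_s' Q s s' = 1.

Fixpoint path_weight (Q : state -> state -> R) (s : state) (h : seq state) : R :=
  if h is s' :: h' then Q s s' * path_weight Q s' h' else 1.

Definition is_path_measure (Q : state -> state -> R) (s : state)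
    (mu : probability (g_sigma_algebraType cylinders) R) : Prop :=
  forall (s0 : state) (h : seq state),
    mu (cylinder (s0 :: h)) = ((s0 == s)%:R * path_weight Q s h)%:E.

Definition visits (T : {set state}) : set path_space :=
  [set w | exists k, w k \in T].

(* For stochastic Q the path measure from s exists and is unique, so [xget] picks
   the probability it assigns to the paths visiting T. *)
Definition reach_prob (Q : state -> state -> R) (T : {set state})
    (s : state) : R :=
  xget 0 [set r : R | exists mu : probability (g_sigma_algebraType cylinders) R,
    is_path_measure Q s mu /\ mu (visits T) = r%:E].

End MarkovChain.

Record pMC (n m : nat) := MkpMC {
  pmc_init : 'I_n.+1;
  pmc_target : {set 'I_n.+1};
  pmc_trans : 'I_n.+1 -> 'I_n.+1 -> mpoly.mpoly m rat }.

Section pMCSemantics.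
Variable R : realType.

Definition instantiation (m : nat) : Type := 'I_m -> R.

Definition poly_eval (m : nat) (u : instantiation m)
    (p : mpoly.mpoly m rat) : R := mpoly.mmap (@ratr R) u p.

Section Fixed.
Variables (n m : nat) (M : pMC n m).

Definition instantiate (u : instantiation m) (s s' : 'I_n.+1) : R :=
  poly_eval u (pmc_trans M s s').

Definition well_defined (u : instantiation m) : Prop :=
  is_stochastic (instantiate u).

Definition graph_preserving (u : instantiation m) : Prop :=
  well_defined u /\
  forall s s', pmc_trans M s s' != 0 -> instantiate u s s' != 0.

Definition graph_preserving_region (D : set (instantiation m)) : Prop :=
  forall u, D u -> graph_preserving u.

Definition sol (s : 'I_n.+1) (u : instantiation m) : R :=
  reach_prob (instantiate u) (pmc_target M) s.

End Fixed.

Definition inst_shift (m : nat) (u : instantiation m) (i : 'I_m) (b : R) :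
    instantiation m := fun j => u j + b * (j == i)%:R.

(* The solution function is meaningful only where the pMC is well-defined, hence
   both points compared are taken in D. *)
Definition monotonic_increasing (m : nat) (f : instantiation m -> R) (i : 'I_m)
    (D : set (instantiation m)) : Prop :=
  forall (u : instantiation m) (b : R),
    D u -> 0 <= b -> D (inst_shift u i b) -> f u <= f (inst_shift u i b).

Definition pMC_monotonic_increasing (n m : nat) (M : pMC n m) (p : 'I_m)
    (D : set (instantiation m)) : Prop :=
  monotonic_increasing (sol M (pmc_init M)) p D.

End pMCSemantics.

(* A polynomial is given as a sum of terms, each a rational coefficient times a
   product of powers of variables. *)
Definition poly_code (m : nat) : Type := seq (rat * seq ('I_m * nat)).

Definition poly_of_code (m : nat) (c : poly_code m) : mpoly.mpoly m rat :=
  \sum_(t <- c)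
    t.1 *: \prod_(x <- t.2) mpoly.mpolyX rat (mpoly.mnm1 x.1) ^+ x.2.

(* Quantifier-free formulas describe the semialgebraic sets over rat. *)
Inductive formula (m : nat) :=
  | FPos of poly_code m
  | FZero of poly_code m
  | FNot of formula m
  | FAnd of formula m & formula m
  | FOr of formula m & formula m.

Fixpoint region (R : realType) (m : nat) (phi : formula m) :
    set (instantiation R m) :=
  match phi with
  | FPos c => [set u | 0 < poly_eval u (poly_of_code c)]
  | FZero c => [set u | poly_eval u (poly_of_code c) = 0]
  | FNot phi1 => ~` region phi1
  | FAnd phi1 phi2 => region phi1 `&` region phi2
  | FOr phi1 phi2 => region phi1 `|` region phi2
  end.
Arguments region R {m} phi.

(* The transitions are listed sparsely; repeated entries are added up. *)
Record pMC_code (n m : nat) := PMCCode {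
  code_init : 'I_n.+1;
  code_target : seq 'I_n.+1;
  code_trans : seq ('I_n.+1 * 'I_n.+1 * poly_code m) }.

Definition pMC_of_code (n m : nat) (c : pMC_code n m) : pMC n m :=
  MkpMC (code_init c) [set s in code_target c]%SET
    (fun s s' => \sum_(e <- code_trans c | e.1 == (s, s')) poly_of_code e.2).

Record verification_instance := VerificationInstance {
  vi_states : nat; (* one less than the number of states *)
  vi_params : nat;
  vi_pmc : pMC_code vi_states vi_params;
  vi_threshold : rat;
  vi_region : formula vi_params }.

Record monotonicity_instance := MonotonicityInstance {
  mi_states : nat; (* one less than the number of states *)
  mi_params : nat;
  mi_pmc : pMC_code mi_states mi_params;
  mi_param : 'I_mi_params;
  mi_region : formula mi_params }.

Inductive letter := Bit of bool | Open | Close.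

Definition sum_of_letter (a : letter) : bool + bool :=
  match a with Bit b => inl b | Open => inr true | Close => inr false end.

Definition letter_of_sum (x : bool + bool) : letter :=
  match x with inl b => Bit b | inr true => Open | inr false => Close end.

Lemma sum_of_letterK : cancel sum_of_letter letter_of_sum.
Proof. by case. Qed.

HB.instance Definition _ := Finite.copy letter (can_type sum_of_letterK).

(* Binary digits, least significant first; k only bounds the recursion. *)
Fixpoint bits_rec (k n : nat) : seq bool :=
  if k is k'.+1 then
    if n == 0%N then [::] else odd n :: bits_rec k' n./2
  else [::].

Definition bits (n : nat) : seq bool := bits_rec n n.

Definition enc_bits (s : seq bool) : seq letter :=
  Open :: rcons (map Bit s) Close.

Definition enc_nat (n : nat) : seq letter := enc_bits (bits n).

Definition enc_rat (q : rat) : seq letter :=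
  enc_bits ((q < 0) :: bits `|numq q|%N) ++ enc_nat `|denq q|%N.

Definition enc_seq (T : Type) (e : T -> seq letter) (s : seq T) : seq letter :=
  Open :: rcons (flatten (map e s)) Close.

Definition enc_poly (m : nat) : poly_code m -> seq letter :=
  enc_seq (fun t : rat * seq ('I_m * nat) =>
    enc_rat t.1 ++
    enc_seq (fun x : 'I_m * nat => enc_nat x.1 ++ enc_nat x.2) t.2).

Fixpoint enc_formula (m : nat) (phi : formula m) : seq letter :=
  match phi with
  | FPos c => enc_nat 0 ++ enc_poly c
  | FZero c => enc_nat 1 ++ enc_poly c
  | FNot phi1 => enc_nat 2 ++ enc_formula phi1
  | FAnd phi1 phi2 => enc_nat 3 ++ enc_formula phi1 ++ enc_formula phi2
  | FOr phi1 phi2 => enc_nat 4 ++ enc_formula phi1 ++ enc_formula phi2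
  end.

Definition enc_pMC (n m : nat) (c : pMC_code n m) : seq letter :=
  enc_nat n.+1 ++ enc_nat (code_init c) ++
  enc_seq (fun s : 'I_n.+1 => enc_nat s) (code_target c) ++
  enc_nat m ++
  enc_seq (fun e : 'I_n.+1 * 'I_n.+1 * poly_code m =>
             enc_nat e.1.1 ++ enc_nat e.1.2 ++ enc_poly e.2) (code_trans c).

Definition enc_verification (x : verification_instance) : seq letter :=
  enc_pMC (vi_pmc x) ++ enc_rat (vi_threshold x) ++ enc_formula (vi_region x).

Definition enc_monotonicity (x : monotonicity_instance) : seq letter :=
  enc_pMC (mi_pmc x) ++ enc_nat (mi_param x) ++ enc_formula (mi_region x).

Section Problems.
Variable R : realType.

Definition verification_promise (x : verification_instance) : Prop :=
  0 <= vi_threshold x <= 1 /\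
  graph_preserving_region (pMC_of_code (vi_pmc x)) (region R (vi_region x)).

Definition verification_holds (x : verification_instance) : Prop :=
  let M := pMC_of_code (vi_pmc x) in
  forall u : instantiation R (vi_params x),
    region R (vi_region x) u -> ratr (vi_threshold x) <= sol M (pmc_init M) u.

Definition verification_problem : promise_problem letter :=
  {| yes_instance := fun w => exists x, [/\ w = enc_verification x,
       verification_promise x & verification_holds x];
     no_instance := fun w => exists x, [/\ w = enc_verification x,
       verification_promise x & ~ verification_holds x] |}.

Definition monotonicity_promise (x : monotonicity_instance) : Prop :=
  graph_preserving_region (pMC_of_code (mi_pmc x)) (region R (mi_region x)).

Definition monotonicity_holds (x : monotonicity_instance) : Prop :=
  pMC_monotonic_increasing (pMC_of_code (mi_pmc x)) (mi_param x)
    (region R (mi_region x)).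

Definition monotonicity_problem : promise_problem letter :=
  {| yes_instance := fun w => exists x, [/\ w = enc_monotonicity x,
       monotonicity_promise x & monotonicity_holds x];
     no_instance := fun w => exists x, [/\ w = enc_monotonicity x,
       monotonicity_promise x & ~ monotonicity_holds x] |}.

End Problems.

(* Main.v *)
(* Given a pMC with threshold lambda, add a fresh initial state that moves to the
   old initial state with probability p, to a new target with probability
   1/2 - p * x, and to a new sink with the remaining probability, where p is a fresh
   parameter ranging over ]0, 1/4[ and x a fresh parameter forced to equal lambda.
   The new solution function is p * sol + 1/2 - p * lambda, which is increasing in p
   exactly where sol >= lambda. Keeping p below 1/4 keeps all three probabilities
   positive even if lambda is 0 or 1, and having x as a parameter means that lambda is
   only copied, never negated.

   Since state and parameter indices of the old pMC are kept, the output is a fixed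
   concatenation of constants, of copies of parts of the input, and of the number of
   states plus a constant. A finite-state one-pass scan can therefore store the pieces
   on separate tapes and a second pass can write them out.

   The semantics is handled through reach_prob as the limit of bounded reachability
   probabilities; the path measure exists as the image of Lebesgue measure on [0, 1[
   under the coding of paths by nested intervals. *)
From HB Require Import structures.
From mathcomp Require Import all_boot all_order all_algebra.
From mathcomp Require Import all_classical all_reals all_analysis.
From mathcomp.multinomials Require mpoly.
Import (canonicals) mpoly.
From mathcomp Require Import zify ring lra.
Require Import Defs.

Set Implicit Arguments.
Unset Strict Implicit.
Unset Printing Implicit Defensive.
Import Order.TTheory GRing.Theory Num.Theory.
Import numFieldNormedType.Exports.
Local Open Scope ring_scope.
Local Open Scope classical_set_scope.

(** * Buffered transducers run in polynomial time *)

Section BufferedTransducer.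
Variables (A Q : finType) (q0 : Q) (next : Q -> A -> Q) (L : nat).
Variables (push : Q -> A -> 'I_L -> option A) (final : Q -> 'I_L -> option A).

(** Each buffer receives at most one letter per letter read and at most one when the input ends, so
    its length is at most [size w + 1]. *)
Fixpoint buffer (q : Q) (w : seq A) (i : 'I_L) : seq A :=
  if w is a :: w' then seq_of_opt (push q a i) ++ buffer (next q a) w' i
  else seq_of_opt (final q i).

Definition buffered_transducer (w : seq A) : seq A :=
  flatten [seq buffer q0 w i | i <- enum 'I_L].

(* [inl q]: reading the input; [inr (Some k)]: emptying the buffers of index
   below [k], from the last one to the first; [inr None]: halted. *)
Definition bt_state : finType := (Q + option 'I_L.+1)%type.

(** Tape 0 holds first the input, then the output; tape [lift ord0 i] is buffer [i]. While reading,
    the head of a buffer rests on the blank after its last letter; at the end of the input it is put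
    on the last letter. The output is written leftwards from the end of the input, over the input
    itself, and the last move returns to its first letter. *)
Definition bt_delta (st : bt_state) (c : {ffun 'I_L.+1 -> option A}) :
    bt_state * {ffun 'I_L.+1 -> option A * move} :=
  match st with
  | inl q =>
    if c ord0 is Some a then
      (inl (next q a), [ffun j => if unlift ord0 j is Some i then
          if push q a i is Some b then (Some b, MoveRight) else (c j, Stay)
        else (c j, MoveRight)])
    else
      (inr (Some ord_max), [ffun j => if unlift ord0 j is Some i then
          if final q i is Some b then (Some b, Stay) else (c j, MoveLeft)
        else (c j, Stay)])
  | inr (Some k) =>
    if unlift ord0 k is Some i then
      if c k is Some a then
        (st, [ffun j => if j == ord0 then (Some a, MoveLeft)
                        else if j == k then (c j, MoveLeft) else (c j, Stay)])
      else (inr (Some (inord i)), [ffun j => (c j, Stay)])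
    else (inr None, [ffun j => (c j, if j == ord0 then MoveRight else Stay)])
  | inr None => (st, [ffun j => (c j, Stay)])
  end.

Definition bt_machine : TM A :=
  @MkTM A L bt_state (inl q0) (fun st => st == inr None) bt_delta.

Local Notation step := (@tm_step A bt_machine).
Local Notation tapes := {ffun 'I_L.+1 -> tape A}.

Lemma tape_write_cur (t : tape A) : tape_write (tape_cur t) t = t.
Proof. by case: t. Qed.

Lemma iter_halted (c : config bt_machine) t :
  tm_halt c.1 -> iter t step c = c.
Proof. by move=> hc; elim: t => //= t ->; rewrite /tm_step hc. Qed.

(** The buffer contents [s] and the part [l] already read are arbitrary for the sake of the
    induction. At the end a buffer is seen leftwards from its last letter, hence reversed. *)
Lemma bt_read q w (s : 'I_L -> seq A) l (ts : tapes) :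
  ts ord0 = Tape l (ohead w) (map Some (behead w)) ->
  (forall i, ts (lift ord0 i) = Tape (map Some (s i)) None [::]) ->
  exists ts' : tapes,
  [/\ iter (size w).+1 step (inl q : bt_state, ts) = (inr (Some ord_max), ts'),
      tape_right (ts' ord0) = [::] &
      forall i, until_blank
        (tape_cur (ts' (lift ord0 i)) :: tape_left (ts' (lift ord0 i))) =
        rev (buffer q w i) ++ s i].
Proof.
elim: w q s l ts => [|a w IH] q s l ts h0 hs.
  eexists; split.
  - rewrite /= /tm_step /= !ffunE h0 /=; reflexivity.
  - by rewrite !ffunE unlift_none h0.
  move=> i; rewrite !ffunE liftK /=.
  case: (final q i) => [b|] /=; rewrite hs /=.
    by congr cons; elim: (s i) => //= c u ->.
  by case: (s i) => //= c u; congr cons; elim: u => //= d u ->.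
rewrite iterSr.
have -> : step (inl q : bt_state, ts) = (inl (next q a) : bt_state,
    [ffun j => if unlift ord0 j is Some i then
       Tape (map Some (seq_of_opt (push q a i) ++ s i)) None [::]
     else Tape (Some a :: l) (ohead w) (map Some (behead w))]).
  rewrite /tm_step /= !ffunE h0 /=; congr pair.
  apply/ffunP => j; rewrite !ffunE.
  case: unliftP => [i ->|->] /=; rewrite ?hs ?h0 /=; last by case: (w).
  by case: (push q a i).
have [||ts' [-> r0 st]] := IH (next q a)
  (fun i => seq_of_opt (push q a i) ++ s i) (Some a :: l)
  [ffun j => if unlift ord0 j is Some i then
       Tape (map Some (seq_of_opt (push q a i) ++ s i)) None [::]
     else Tape (Some a :: l) (ohead w) (map Some (behead w))].
- by rewrite ffunE unlift_none.
- by move=> i; rewrite ffunE liftK.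
exists ts'; split=> // i; rewrite st /= rev_cat -catA; congr (_ ++ _).
by case: (push q a i).
Qed.

(** The buffer is read from its last letter and the output grows leftwards, so [v], the reversed
    buffer, is put back in order. *)
Lemma bt_pop (k : 'I_L) v (ts : tapes) out :
  until_blank (tape_cur (ts (lift ord0 k)) :: tape_left (ts (lift ord0 k))) = v ->
  tape_right (ts ord0) = map Some out ->
  exists ts' : tapes,
  [/\ iter (size v).+1 step (inr (Some (lift ord0 k)) : bt_state, ts) =
        (inr (Some (inord k)), ts'),
      tape_right (ts' ord0) = map Some (rev v ++ out) &
      forall i, i != k -> ts' (lift ord0 i) = ts (lift ord0 i)].
Proof.
elim: v ts out => [|a v IH] ts out.
  move=> hk h0; exists ts; split=> //.
  rewrite /= /tm_step /= liftK ffunE.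
  case: (ts (lift ord0 k)) hk => l [//|] r _ /=.
  by congr pair; apply/ffunP => j; rewrite !ffunE /= tape_write_cur.
case ek: (ts (lift ord0 k)) => [l [b|//] r] [eb hk] h0; subst b.
rewrite iterSr.
set ts1 : tapes := [ffun j =>
  if j == ord0 then tape_move MoveLeft (tape_write (Some a) (ts j))
  else if j == lift ord0 k then tape_move MoveLeft (ts j) else ts j].
have -> : step (inr (Some (lift ord0 k)) : bt_state, ts) =
    (inr (Some (lift ord0 k)) : bt_state, ts1).
  rewrite /tm_step /= liftK !ffunE ek /=; congr pair.
  apply/ffunP => j; rewrite !ffunE.
  by case: eqP => // _; case: eqP => _; case: (ts j).
have [||ts' [-> r0 st]] := IH ts1 (a :: out).
- rewrite ffunE /= eqxx ek /=.
  by case: (l) hk => // c l'.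
- by rewrite ffunE eqxx; move: h0; case: (ts ord0) => /= ? ? ? ->.
exists ts'; split=> //; first by rewrite r0 rev_cons cat_rcons.
by move=> i ik; rewrite st // ffunE /= (inj_eq lift_inj) (negPf ik).
Qed.

Lemma bt_pop_all (s : 'I_L -> seq A) (b k : nat) (ts : tapes) out :
  (k <= L)%N -> (forall i, size (s i) <= b)%N ->
  (forall i : 'I_L, (i < k)%N -> until_blank
     (tape_cur (ts (lift ord0 i)) :: tape_left (ts (lift ord0 i))) = rev (s i)) ->
  tape_right (ts ord0) = map Some out ->
  exists ts' : tapes, exists2 t : nat, (t <= k * b.+1)%N &
     iter t step (inr (Some (inord k)) : bt_state, ts) = (inr (Some ord0), ts') /\
     tape_right (ts' ord0) =
       map Some (flatten [seq s i | i <- take k (enum 'I_L)] ++ out).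
Proof.
move=> + hb; elim: k ts out => [|k IH] ts out kL hs h0.
  exists ts, 0%N => //=; split; last by rewrite take0.
  by congr (inr (Some _), _); apply/val_inj; rewrite /= inordK.
pose k' := Ordinal kL.
have [ts1 [e1 r1 st1]] := bt_pop (hs k' (leqnn _)) h0.
have ek : inord k.+1 = lift ord0 k' by apply/val_inj; rewrite /= inordK.
have [||ts' [t tk [e2 r2]]] := IH ts1 (s k' ++ out) (ltnW kL).
- by move=> i ik; rewrite st1 ?hs 1?ltnW // neq_ltn ik.
- by rewrite r1 revK.
exists ts', (t + (size (rev (s k'))).+1)%N.
  by rewrite mulSn addnC leq_add // size_rev ltnS.
rewrite iterD ek e1 e2 r2; split=> //; congr map.
rewrite (take_nth k') ?size_enum_ord // map_rcons flatten_rcons -catA.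
by rewrite (nth_ord_enum k' k').
Qed.

Lemma size_buffer q w i : (size (buffer q w i) <= (size w).+1)%N.
Proof.
elim: w q => [|a w IH] q /=; first by case: (final q i).
by rewrite size_cat -add1n leq_add //; case: (push q a i).
Qed.

Theorem buffered_transducer_polytime :
  polytime_computable buffered_transducer.
Proof.
(* Reading takes [size w + 1] steps, emptying at most [L * (size w + 2)], and the final move one. *)
exists bt_machine, (Poly [:: L.*2.+2; L.+1]) => w.
have [||ts [e1 r1 st1]] := @bt_read q0 w (fun=> [::]) [::] (tm_init bt_machine w).2.
- by rewrite ffunE.
- by move=> i; rewrite ffunE.
have [|||ts' [t tb [e2 r2]]] :=
    @bt_pop_all (buffer q0 w) (size w).+1 L ts [::] (leqnn L).
- by move=> i; exact: size_buffer.
- by move=> i _; rewrite st1 cats0.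
- by rewrite r1.
have eL : inord L = ord_max :> 'I_L.+1 by apply/val_inj; rewrite /= inordK.
have e3 : step (inr (Some ord0) : bt_state, ts') = (inr None : bt_state,
    [ffun j => if j == ord0 then tape_move MoveRight (ts' j) else ts' j]).
  rewrite /tm_step /= unlift_none /=; congr pair; apply/ffunP => j.
  by rewrite !ffunE; case: eqP => _; case: (ts' j).
have e : iter (1 + (t + (size w).+1)) step (tm_init bt_machine w) =
    (inr None : bt_state,
    [ffun j => if j == ord0 then tape_move MoveRight (ts' j) else ts' j]).
  by rewrite iterD iterD e1 -eL e2 /= e3.
have hT : (1 + (t + (size w).+1) <= (Poly [:: L.*2.+2; L.+1]).[size w])%N.
  rewrite horner_Poly /= mul0r add0r.
  rewrite -[(_ * _ + _)%R]/(_ * _ + _)%N.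
  by move: tb; nia.
(* The machine may halt before the time bound: halting configurations are fixed. *)
rewrite /tm_computes_in -(subnK hT) iterD e iter_halted //=; split=> //.
rewrite ffunE eqxx /word_of_tape; move: r2.
rewrite cats0 take_oversize ?size_enum_ord // -/(buffered_transducer w).
case: (ts' ord0) => l c r /= ->.
by case: (buffered_transducer w) => //= a v; congr cons; elim: v => //= ? ? ->.
Qed.

End BufferedTransducer.

Section BufferList.
Variables (A Q : finType) (I : Type) (q0 : Q) (next : Q -> A -> Q).
Variables (push : Q -> A -> I -> option A) (final : Q -> I -> option A).

(** Unlike [buffer], this leaves out the final letter, so that it splits along concatenations of
    inputs. *)
Fixpoint emit (q : Q) (w : seq A) (i : I) : seq A :=
  if w is a :: w' then seq_of_opt (push q a i) ++ emit (next q a) w' i else [::].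

Definition item_output (w : seq A) (i : I) : seq A :=
  emit q0 w i ++ seq_of_opt (final (foldl next q0 w) i).

Lemma emit_cat q u v i : emit q (u ++ v) i = emit q u i ++ emit (foldl next q u) v i.
Proof. by elim: u q => //= a u IH q; rewrite IH catA. Qed.

(** The program does not depend on the input, so its positions can serve as the buffer indices of
    one machine. *)
Lemma items_polytime (prog : seq I) :
  polytime_computable (fun w => flatten (map (item_output w) prog)).
Proof.
pose t := in_tuple prog.
rewrite (_ : (fun w => _) = buffered_transducer q0 next
  (fun q a i => push q a (tnth t i)) (fun q i => final q (tnth t i))).
  exact: buffered_transducer_polytime.
apply/funext => w; rewrite /buffered_transducer.
rewrite -[prog in LHS](map_tnth_enum t) -map_comp; congr flatten; apply: eq_map => i /=.
by rewrite /item_output; elim: w q0 => //= a w IH q; rewrite -catA IH.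
Qed.

End BufferList.

(** * The reduction on encodings *)

Lemma bits_recE k n : (n <= k)%N -> bits_rec k n = bits n.
Proof.
rewrite /bits; have [l] := ubnP n; elim: l n k => // l IH [|n] [|k] //= nl nk.
congr cons; rewrite !IH //; lia.
Qed.

Lemma bitsE n : bits n = if n == 0%N then [::] else odd n :: bits n./2.
Proof. by case: n => //= n; rewrite /bits /= bits_recE //; lia. Qed.

Lemma bits_doubleS n : bits n.*2.+1 = true :: bits n.
Proof. by rewrite bitsE /= odd_double uphalf_double. Qed.

(** Adds a constant in one pass over the digits, least significant first; the carry is a number
    whose initial value is the summand. *)
Fixpoint sum_bits (c : nat) (s : seq bool) : seq bool :=
  if s is b :: s' then odd (b + c) :: sum_bits (b + c)./2 s' else [::].

Definition sum_carry (c : nat) (s : seq bool) : nat :=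
  foldl (fun c (b : bool) => (b + c)./2) c s.

Lemma bits_add n c :
  bits (n + c) = sum_bits c (bits n) ++ bits (sum_carry c (bits n)).
Proof.
have [l] := ubnP n; elim: l n c => // l IH n c nl.
rewrite [bits n]bitsE; case: eqVneq => [->|n0]; first by [].
rewrite /= -IH; last by lia.
by rewrite [LHS]bitsE (_ : (n + c == 0)%N = false) /=; [congr (_ :: bits _)|]; lia.
Qed.

(** Carries that start at most 3 remain so: they fit into ['I_4] and have at most two digits, one
    for each [Carry] item. *)
Lemma sum_carry_le c k s : (c <= k.+1)%N -> (sum_carry c s <= k.+1)%N.
Proof. by elim: s c => //= b s IH c ck; apply: IH; case: b; lia. Qed.

(* [Copy g] outputs group [g] of the input without its opening bracket ([Copy 7]:
   everything after the seventh group); [Sum c] and [Carry c j] output the digits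
   of the number encoded by group 0 plus [c]: those in the range of the digits of
   that number, and the [j]-th of the further ones. *)
Inductive item := Const of letter | Copy of nat | Sum of nat | Carry of nat & nat.

(* Current group, nesting depth inside the group, carries of the sums [+ c]. *)
Definition scan_state : finType := ('I_8 * 'I_5 * {ffun 'I_4 -> 'I_4})%type.

Definition scan_start : scan_state := (ord0, ord0, [ffun c => c]).

(** Groups 0 to 6 are the number of states, the initial state, the targets, the number of
    parameters, the transitions, and the two halves of the threshold. Group 7 is the formula, a
    sequence of arbitrarily many bracketed words, and is never left. *)
Definition scan_next (q : scan_state) (a : letter) : scan_state :=
  let: (g, d, k) := q in
  match a with
  | Open => (g, inord d.+1, k)
  | Close =>
    if (g < 7)%N && (d == 1%N :> nat) then (inord g.+1, ord0, k)
    else (g, inord d.-1, k)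
  | Bit b => (g, d, if g == ord0 then [ffun c => inord (b + k c)./2] else k)
  end.

(** Dropping the bracket that opens a group lets the output put further digits or entries in front
    of the copied ones. *)
Definition scan_push (q : scan_state) (a : letter) (i : item) : option letter :=
  let: (g, d, k) := q in
  match i with
  | Copy g' =>
    if (g == g' :> nat) && ~~ [&& (g < 7)%N, a == Open & d == ord0] then Some a
    else None
  | Sum c =>
    if a is Bit b then
      if g == ord0 then Some (Bit (odd (b + k (inord c)))) else None
    else None
  | _ => None
  end.

(** The carries are complete only after group 0; the state keeps them until the input ends. *)
Definition scan_final (q : scan_state) (i : item) : option letter :=
  match i with
  | Const a => Some a
  | Carry c j => ohead (drop j (map Bit (bits (q.2 (inord c)))))
  | _ => None
  end.

Local Notation scan_emit := (emit scan_next scan_push).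
Local Notation scan := (foldl scan_next).

(* Holds when the brackets of [v] are balanced and nested at most [h] deep, so that
   the bounded depth counter does not overflow. *)
Definition copied (h : nat) (v : seq letter) : Prop :=
  forall (g : 'I_8) (d : 'I_5) k, (0 < g < 7)%N -> (0 < d)%N -> (d + h <= 4)%N ->
  scan (g, d, k) v = (g, d, k) /\
  forall g', scan_emit (g, d, k) v (Copy g') = if g' == g :> nat then v else [::].

Lemma copied_nil h : copied h [::].
Proof. by move=> g d k *; split=> // g'; case: ifP. Qed.

Lemma copied_cat h u v : copied h u -> copied h v -> copied h (u ++ v).
Proof.
move=> hu hv g d k g0 d0 dh.
have [eu eu'] := hu g d k g0 d0 dh; have [ev ev'] := hv g d k g0 d0 dh.
rewrite foldl_cat eu ev; split=> // g'; rewrite emit_cat eu eu' ev'.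
by case: ifP.
Qed.

Lemma copied_flatten h T (e : T -> seq letter) s :
  (forall x, copied h (e x)) -> copied h (flatten (map e s)).
Proof.
by move=> he; elim: s => [|x s IH]; [exact: copied_nil|exact: copied_cat].
Qed.

Lemma copied_bits h s : copied h (map Bit s).
Proof.
elim: s => [|b s IH]; first exact: copied_nil.
rewrite /= -cat1s; apply: copied_cat => // g d k /andP[g0 g7] d0 dh.
rewrite /= -val_eqE /= eqn0Ngt g0; split=> // g'.
by rewrite andbF andbT eq_sym; case: ifP.
Qed.

Lemma copied_bracket h v : copied h v -> copied h.+1 (Open :: rcons v Close).
Proof.
move=> hv g d k g07 d0 dh; have /andP[g0 g7] := g07.
have ed : (inord d.+1 : 'I_5) = d.+1 :> nat by rewrite inordK //; lia.
have [||ev ev'] := hv g (inord d.+1) k g07; rewrite ?ed //; first by lia.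
(* The closing bracket is met at depth [d + 1 > 1], so it does not end the group. *)
rewrite -cats1 /= foldl_cat ev /= g7 ed eqSS eqn0Ngt d0 /= inord_val; split=> // g'.
rewrite emit_cat ev ev' /= g7 -[d == _]val_eqE /= eqn0Ngt d0 /= !andbT eq_sym.
by case: ifP.
Qed.

Lemma copied_enc_bits h s : copied h.+1 (enc_bits s).
Proof. exact/copied_bracket/copied_bits. Qed.

Lemma copied_enc_seq h T (e : T -> seq letter) s :
  (forall x, copied h (e x)) -> copied h.+1 (enc_seq e s).
Proof. by move=> he; exact/copied_bracket/copied_flatten. Qed.

Lemma copied_enc_poly h m (c : poly_code m) : copied h.+3 (enc_poly c).
Proof.
apply: copied_enc_seq => t; apply: copied_cat.
  by apply: copied_cat; exact: copied_enc_bits.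
by apply: copied_enc_seq => x; apply: copied_cat; exact: copied_enc_bits.
Qed.

Lemma scan_group (g : 'I_8) k v : (0 < g < 7)%N -> copied 3 v ->
  scan (g, ord0, k) (Open :: rcons v Close) = (inord g.+1, ord0, k) /\
  forall g', scan_emit (g, ord0, k) (Open :: rcons v Close) (Copy g') =
    if g' == g :> nat then rcons v Close else [::].
Proof.
move=> g07 hv; have /andP[g0 g7] := g07.
have e1 : (inord 1 : 'I_5) = 1%N :> nat by rewrite inordK.
have [||ev ev'] := hv g (inord 1) k g07; rewrite ?e1 //.
rewrite -cats1 /= foldl_cat ev /= g7 e1 eqxx /=; split=> // g'.
by rewrite emit_cat ev ev' /= g7 /= andbF /= eq_sym; case: ifP => // _; rewrite andbT.
Qed.

Lemma scan_emit_sum (g : 'I_8) d k v c :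
  (0 < g)%N -> scan_emit (g, d, k) v (Sum c) = [::].
Proof.
elim: v g d k => //= a v IH g d k g0; rewrite -[g == _]val_eqE /= eqn0Ngt g0 /=.
case: a => [b||] /=; rewrite ?IH //.
by case: ifP => [/andP[g7 _]|_]; rewrite IH // inordK.
Qed.

Lemma scan_emit_rest (d : 'I_5) k v g' :
  scan_emit (ord_max, d, k) v (Copy g') = if g' == 7%N then v else [::].
Proof.
elim: v d k => [|a v IH] d k /=; first by case: ifP.
by rewrite andbT eq_sym; case: a => [b||] /=; rewrite IH; case: ifP.
Qed.

Lemma scan_number s :
  let k := [ffun c : 'I_4 => inord (sum_carry c s)] in
  scan scan_start (enc_bits s) = (inord 1, ord0, k) /\
  (forall g', scan_emit scan_start (enc_bits s) (Copy g'.+1) = [::]) /\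
  (forall c, (c < 4)%N ->
    scan_emit scan_start (enc_bits s) (Sum c) = map Bit (sum_bits c s)).
Proof.
rewrite /enc_bits -cats1 /= foldl_cat.
have e1 : (inord 1 : 'I_5) = 1%N :> nat by rewrite inordK.
(* The induction on the digits needs arbitrary initial carries. *)
have E (k : {ffun 'I_4 -> 'I_4}) :
    scan (ord0, inord 1, k) (map Bit s) =
      (ord0, inord 1, [ffun c : 'I_4 => inord (sum_carry (k c) s)]) /\
    (forall c, scan_emit (ord0, inord 1, k) (map Bit s) (Sum c) =
      map Bit (sum_bits (k (inord c)) s)) /\
    forall g', scan_emit (ord0, inord 1, k) (map Bit s) (Copy g'.+1) = [::].
  elim: s k => [|b s IH] k /=.
    by split=> //; congr (_, _); apply/ffunP => c; rewrite ffunE inord_val.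
  have [-> [H1 H2]] := IH [ffun c => inord (b + k c)./2].
  (* The new carry is at most 2, so [inord] does not alter it. *)
  have H c : (inord (b + k c)./2 : 'I_4) = (b + k c)./2 :> nat.
    by rewrite inordK //; have := ltn_ord (k c); case: (b); lia.
  split; first by congr (_, _); apply/ffunP => c; rewrite !ffunE /= H.
  by split=> [c|g']; rewrite ?H1 ?H2 // ffunE H.
have [H0 [H1 H2]] := E [ffun c => c].
rewrite H0 /= e1 /=; split.
  by congr (_, _); apply/ffunP => c; rewrite !ffunE.
split=> [g'|c c4]; rewrite emit_cat ?H1 ?H2 /= ?H0 //= cats0.
by rewrite ffunE inordK.
Qed.

Definition scan_output : seq letter -> item -> seq letter :=
  item_output scan_start scan_next scan_push scan_final.

Definition bracket (v : seq letter) : seq letter := Open :: rcons v Close.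

Lemma scan_groups (vs : seq (seq letter)) rest (g : nat) k :
  (forall v, v \in vs -> copied 3 v) -> (0 < g)%N -> (g + size vs = 7)%N ->
  let w := flatten (map bracket vs) ++ rest in
  (scan (inord g, ord0, k) w).2 = (scan (ord_max, ord0, k) rest).2 /\
  forall g', scan_emit (inord g, ord0, k) w (Copy g') =
    if (g <= g' < 7)%N then rcons (nth [::] vs (g' - g)) Close
    else if g' == 7%N then rest else [::].
Proof.
elim: vs g k => [|v vs IH] g k hvs g0.
  rewrite addn0 => -> /=.
  have -> : inord 7 = ord_max :> 'I_8 by apply/val_inj; rewrite /= inordK.
  split=> // g'; rewrite scan_emit_rest; case: ifP => [/eqP-> //|_].
  by rewrite ifF //; lia.
move=> gs w; rewrite [size _]/= in gs.
have g7 : (inord g : 'I_8) = g :> nat by rewrite inordK; lia.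
have [||E1 E2] := @scan_group (inord g) k v.
- by rewrite g7; lia.
- by apply: hvs; rewrite mem_head.
have [|//||H1 H2] := IH g.+1 k.
- by move=> u uvs; apply: hvs; rewrite in_cons uvs orbT.
- by lia.
rewrite g7 -/(bracket v) in E1 E2.
have -> : w = bracket v ++ flatten (map bracket vs) ++ rest by rewrite /w -catA.
rewrite foldl_cat E1 H1; split=> // g'; rewrite emit_cat E2 E1 H2.
case: (ltngtP g' g) => [gg|gg|->]; rewrite ?cat0s //.
  by rewrite [X in nth _ (_ :: _) X](_ : _ = (g' - g.+1).+1) //; lia.
rewrite subnn /= (_ : (g < 7)%N) //; last by lia.
by rewrite ifF ?cats0 //; lia.
Qed.

Lemma scan_output_input s vs rest :
  (forall v, v \in vs -> copied 3 v) -> size vs = 6%N ->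
  let w := enc_bits s ++ flatten (map bracket vs) ++ rest in
  [/\ forall a, scan_output w (Const a) = [:: a],
      forall g, (g < 6)%N -> scan_output w (Copy g.+1) = rcons (nth [::] vs g) Close,
      scan_output w (Copy 7) = rest,
      forall c, (c < 4)%N -> scan_output w (Sum c) = map Bit (sum_bits c s) &
      forall c, (c < 4)%N ->
        scan_output w (Carry c 0) ++ scan_output w (Carry c 1) =
        map Bit (bits (sum_carry c s))].
Proof.
move=> hvs svs w.
have [N1 [N2 N3]] := scan_number s.
have [//|||G1 G2] :=
  @scan_groups vs rest 1 [ffun c : 'I_4 => inord (sum_carry c s)] => //.
  by rewrite svs.
have emit0 i : (forall q a, scan_push q a i = None) ->
    forall q v, scan_emit q v i = [::].
  by move=> hi q v; elim: v q => //= a v IH q; rewrite hi IH.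
split.
- by move=> a; rewrite /scan_output /item_output emit0 // => -[[]].
- move=> g g6; rewrite /scan_output /item_output emit_cat N2 N1 G2 /=.
  by rewrite ifT ?subSS ?subn0 ?cats0 //; lia.
- by rewrite /scan_output /item_output emit_cat N2 N1 G2 /= cats0.
- move=> c c4; rewrite /scan_output /item_output emit_cat N3 // N1.
  by rewrite scan_emit_sum ?inordK //= !cats0.
move=> c c4; rewrite /scan_output /item_output !emit0; try by move=> [[]].
have rest2 : forall v d k, (scan (ord_max, d, k) v).2 = k.
  by elim=> // -[b||] v IH d k /=; rewrite IH.
rewrite /scan_final foldl_cat N1 G1 rest2 ffunE.
have cs : (sum_carry c s <= 3)%N by exact: sum_carry_le.
rewrite !inordK //.
by case: (sum_carry c s) cs => [|[|[|[|]]]].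
Qed.

(** * Renaming of parameters *)

Section MapCode.
Variables (m m' : nat) (f : 'I_m -> 'I_m').

Definition map_code (c : poly_code m) : poly_code m' :=
  [seq (t.1, [seq (f x.1, x.2) | x <- t.2]) | t <- c].

Fixpoint map_formula (phi : formula m) : formula m' :=
  match phi with
  | FPos c => FPos (map_code c)
  | FZero c => FZero (map_code c)
  | FNot phi1 => FNot (map_formula phi1)
  | FAnd phi1 phi2 => FAnd (map_formula phi1) (map_formula phi2)
  | FOr phi1 phi2 => FOr (map_formula phi1) (map_formula phi2)
  end.

Hypothesis fE : forall i, f i = i :> nat.

(** Encodings record only the index of a parameter, which [f] preserves. *)
Lemma enc_map_code c : enc_poly (map_code c) = enc_poly c.
Proof.
rewrite /enc_poly /enc_seq -map_comp; congr (_ :: rcons (flatten _) _).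
apply: eq_map => t.
rewrite -[LHS]/(enc_rat t.1 ++ enc_seq _ [seq (f x.1, x.2) | x <- t.2]).
congr (_ ++ _); congr (_ :: rcons (flatten _) _).
by rewrite -map_comp; apply: eq_map => x /=; rewrite fE.
Qed.

Lemma enc_map_formula phi : enc_formula (map_formula phi) = enc_formula phi.
Proof.
by elim: phi => [c|c|p1 IH1|p1 IH1 p2 IH2|p1 IH1 p2 IH2] /=;
  rewrite ?enc_map_code ?IH1 ?IH2.
Qed.

End MapCode.

(** * The reduced instance *)

Section Reduction.
Variables (n m : nat).

(* The fresh parameters are [m] and [2m+1], out of [4m+3] in total: the digits of
   these numbers, least significant first, are those of [m] preceded by zero, one
   and two ones. The other added parameters are not used. *)
Definition red_params : nat := m.*2.+1.*2.+1.

Fact ltn_threshold_param : (m < red_params)%N.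
Proof. by rewrite /red_params; lia. Qed.

Fact ltn_slope_param : (m.*2.+1 < red_params)%N.
Proof. by rewrite /red_params; lia. Qed.

Definition threshold_param : 'I_red_params := Ordinal ltn_threshold_param.
Definition slope_param : 'I_red_params := Ordinal ltn_slope_param.
Definition old_param : 'I_m -> 'I_red_params := widen_ord (ltnW ltn_threshold_param).

Definition fresh_param (i : 'I_2) : 'I_red_params :=
  if i == ord0 then threshold_param else slope_param.

(** New states come after the old ones, which thus keep their encodings. They are, in order, the
    initial state, the accepting state and the sink. *)
Definition new_state (i : 'I_3) : 'I_(n + 3).+1 := rshift n.+1 i.
Definition old_state (s : 'I_n.+1) : 'I_(n + 3).+1 := lshift 3 s.

End Reduction.

(* Polynomials in the two fresh parameters: [ord0] is the threshold, [ord_max]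
   is the parameter in which monotonicity is tested. *)
Definition code_one : poly_code 2 := [:: (1, [::])].
Definition code_enter : poly_code 2 := [:: (1, [:: (ord_max, 1%N)])].
Definition code_accept : poly_code 2 :=
  [:: (2^-1, [::]); (-1, [:: (ord_max, 1%N); (ord0, 1%N)])].
Definition code_reject : poly_code 2 :=
  [:: (2^-1, [::]); (-1, [:: (ord_max, 1%N)]);
      (1, [:: (ord_max, 1%N); (ord0, 1%N)])].
(** With [p] the slope, [p - 4p^2 > 0] confines [p] to ]0, 1/4[ by a single atom. *)
Definition code_range : poly_code 2 :=
  [:: (1, [:: (ord_max, 1%N)]); (- 4%:R, [:: (ord_max, 2%N)])].
Definition code_threshold (lambda : rat) : poly_code 2 :=
  [:: (lambda, [::]); (-1, [:: (ord0, 1%N)])].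

Definition red_pMC (n m : nat) (c : pMC_code n m) : pMC_code (n + 3) (red_params m) :=
  let new := @new_state n in
  let code := map_code (@fresh_param m) in
  {| code_init := new (inord 0);
     code_target := new (inord 1) :: map (@old_state n) (code_target c);
     code_trans :=
       [:: (new (inord 0), old_state (code_init c), code code_enter);
           (new (inord 0), new (inord 1), code code_accept);
           (new (inord 0), new (inord 2), code code_reject);
           (new (inord 1), new (inord 1), code code_one);
           (new (inord 2), new (inord 2), code code_one)] ++
       [seq (old_state e.1.1, old_state e.1.2, map_code (@old_param m) e.2)
         | e <- code_trans c] |}.

Definition reduction (x : verification_instance) : monotonicity_instance :=
  let code := map_code (@fresh_param (vi_params x)) in
  {| mi_states := vi_states x + 3;
     mi_params := red_params (vi_params x);
     mi_pmc := red_pMC (vi_pmc x);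
     mi_param := slope_param (vi_params x);
     mi_region :=
       FAnd (FAnd (FPos (code code_range))
                  (FZero (code (code_threshold (vi_threshold x)))))
            (map_formula (@old_param (vi_params x)) (vi_region x)) |}.

(** * The output as a fixed list of items *)

Definition item_number (c : nat) : seq item :=
  [:: Const Open; Sum c; Carry c 0; Carry c 1; Const Close].

Definition item_param (i : 'I_2) : seq item :=
  Const Open :: (if i == ord0 then [::] else [:: Const (Bit true)]) ++ [:: Copy 3].

Definition item_seq (T : Type) (e : T -> seq item) (s : seq T) : seq item :=
  Const Open :: rcons (flatten (map e s)) (Const Close).

Definition item_term (t : rat * seq ('I_2 * nat)) : seq item :=
  map Const (enc_rat t.1) ++
  item_seq (fun x => item_param x.1 ++ map Const (enc_nat x.2)) t.2.

Definition item_poly : poly_code 2 -> seq item := item_seq item_term.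

Definition items_pMC : seq item :=
  item_number 3 ++ item_number 0 ++ (Const Open :: item_number 1 ++ [:: Copy 2]) ++
  [:: Const Open; Const (Bit true); Const (Bit true); Copy 3] ++
  (Const Open ::
    ((item_number 0 ++ [:: Const Open; Copy 1] ++ item_poly code_enter) ++
     (item_number 0 ++ item_number 1 ++ item_poly code_accept) ++
     (item_number 0 ++ item_number 2 ++ item_poly code_reject) ++
     (item_number 1 ++ item_number 1 ++ item_poly code_one) ++
     (item_number 2 ++ item_number 2 ++ item_poly code_one)) ++ [:: Copy 4]).

(** Groups 5 and 6, the signed numerator and the denominator of the threshold, are reused as the
    coefficient of a constant term. *)
Definition items_threshold : seq item :=
  Const Open :: ([:: Const Open; Copy 5; Const Open; Copy 6] ++
    item_seq (fun x => item_param x.1 ++ map Const (enc_nat x.2)) [::]) ++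
    item_term (-1, [:: (ord0, 1%N)]) ++ [:: Const Close].

Definition items_region : seq item :=
  map Const (enc_nat 3) ++ (map Const (enc_nat 3) ++
    (map Const (enc_nat 0) ++ item_poly code_range) ++
    (map Const (enc_nat 1) ++ items_threshold)) ++ [:: Copy 7].

Definition reduction_items : seq item :=
  items_pMC ++ item_param ord_max ++ items_region.

Lemma enc_seq_cat T (e : T -> seq letter) s1 s2 : enc_seq e (s1 ++ s2) =
  [:: Open] ++ flatten (map e s1) ++ rcons (flatten (map e s2)) Close.
Proof. by rewrite /enc_seq map_cat flatten_cat -rcons_cat. Qed.

Lemma reduction_items_correct x :
  flatten (map (scan_output (enc_verification x)) reduction_items) =
  enc_monotonicity (reduction x).
Proof.
case: x => n m c lambda phi.
(* Groups 1 to 6 of the input, without their outer brackets. *)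
pose vs := [:: map Bit (bits (code_init c));
  flatten (map (fun s : 'I_n.+1 => enc_nat s) (code_target c));
  map Bit (bits m);
  flatten (map (fun e : 'I_n.+1 * 'I_n.+1 * poly_code m =>
             enc_nat e.1.1 ++ enc_nat e.1.2 ++ enc_poly e.2) (code_trans c));
  map Bit ((lambda < 0) :: bits `|numq lambda|%N);
  map Bit (bits `|denq lambda|%N)].
have -> : enc_verification (VerificationInstance c lambda phi) =
    enc_bits (bits n.+1) ++ flatten (map bracket vs) ++ enc_formula phi.
  have flat6 b1 b2 b3 b4 b5 b6 (r : seq letter) :
      flatten [:: b1; b2; b3; b4; b5; b6] ++ r =
      b1 ++ b2 ++ b3 ++ b4 ++ b5 ++ b6 ++ r by rewrite /= cats0 -!catA.
  rewrite -[map bracket vs]/[:: _; _; _; _; _; _] flat6.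
  by rewrite /enc_verification /enc_pMC /enc_rat -!catA.
have hvs v : v \in vs -> copied 3 v.
  rewrite !inE; do 5?[case/orP => [/eqP->|]]; last move/eqP->.
  - exact: copied_bits.
  - by apply: copied_flatten => s; exact: copied_enc_bits.
  - exact: copied_bits.
  - apply: copied_flatten => e; apply: copied_cat; first exact: copied_enc_bits.
    by apply: copied_cat; [exact: copied_enc_bits|exact: copied_enc_poly].
  - exact: copied_bits.
  - exact: copied_bits.
have [] := scan_output_input (bits n.+1) (enc_formula phi) hvs erefl.
(* From here on the input word is known only through what each item writes for it. *)
set w := _ ++ _; move: w => w hC hG hR hS hCa.
pose out its := flatten (map (scan_output w) its).
have out_cat u v : out (u ++ v) = out u ++ out v by rewrite /out map_cat flatten_cat.
have out_const v : out (map Const v) = v.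
  by elim: v => //= a v IH; rewrite /out /= hC -/(out _) IH.
have out_cons i v : out (i :: v) = scan_output w i ++ out v by [].
have out_seq T (e : T -> seq item) s : out (item_seq e s) = enc_seq (out \o e) s.
  rewrite /item_seq -cats1 out_cons out_cat hC out_cons hC /enc_seq /= cats1.
  by congr (_ :: rcons _ _); elim: s => //= y s IH; rewrite out_cat IH.
(* For [k < 3] this number is the index of new state [k], for [k = 3] the new number of states. *)
have out_num k : (k < 4)%N -> out (item_number k) = enc_nat (n.+1 + k).
  move=> k4; rewrite /item_number !out_cons !hC hS // [X in _ ++ _ ++ X]catA hCa //.
  by rewrite /enc_nat /enc_bits bits_add map_cat -cats1 -!catA.
have out_param i : out (item_param i) = enc_nat (fresh_param m i).
  rewrite /item_param /fresh_param; case: ifP => _;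
    rewrite !out_cons !hC ?(hG 2) //= ?cats0 //.
  by rewrite /enc_nat bits_doubleS.
have out_term t : out (item_term t) =
    enc_rat t.1 ++
    enc_seq (fun x : 'I_(red_params m) * nat => enc_nat x.1 ++ enc_nat x.2)
      [seq (fresh_param m x.1, x.2) | x <- t.2].
  rewrite /item_term out_cat out_const out_seq; congr (_ ++ _).
  congr (_ :: rcons (flatten _) _); rewrite -map_comp; apply: eq_map => y.
  by rewrite [LHS]/comp out_cat out_param out_const.
have out_poly q : out (item_poly q) = enc_poly (map_code (@fresh_param m) q).
  rewrite /item_poly out_seq /enc_poly /enc_seq -map_comp.
  by congr (_ :: rcons (flatten _) _); apply: eq_map => t; exact: out_term.
have tgt : flatten [seq enc_nat s
    | s : 'I_(n + 3).+1 <- map (@old_state n) (code_target c)] = nth [::] vs 1.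
  by rewrite -map_comp.
have tr : flatten [seq enc_nat e.1.1 ++ enc_nat e.1.2 ++ enc_poly e.2
    | e : 'I_(n + 3).+1 * 'I_(n + 3).+1 * poly_code (red_params m) <-
       [seq (old_state e.1.1, old_state e.1.2, map_code (@old_param m) e.2)
         | e <- code_trans c]] = nth [::] vs 3.
  rewrite -map_comp; congr flatten; apply: eq_map => e /=.
  by rewrite enc_map_code.
have enew k : (k < 3)%N -> enc_nat (@new_state n (inord k)) = enc_nat (n.+1 + k).
  by move=> k3; rewrite /= inordK.
rewrite /enc_monotonicity -/(out _) /reduction_items 2!out_cat.
congr (_ ++ (_ ++ _)).
- rewrite /items_pMC 4!out_cat; congr (_ ++ (_ ++ (_ ++ (_ ++ _)))).
  + by rewrite out_num.
  + by rewrite out_num // -enew.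
  + rewrite out_cons hC out_cat out_num // out_cons (hG 1%N) // -tgt.
    rewrite -[code_target (mi_pmc _)]/([:: _] ++ _) enc_seq_cat; congr (_ ++ (_ ++ _)).
      by rewrite -enew // -[RHS]/(_ ++ [::]) cats0.
    by rewrite -[out [::]]/[::] cats0.
  + rewrite !out_cons !hC (hG 2%N) // /red_params [RHS]/enc_nat !bits_doubleS.
    by rewrite -[out [::]]/[::] cats0.
  rewrite out_cons hC out_cat out_cons (hG 3%N) // -tr -[out [::]]/[::] cats0.
  rewrite -[code_trans (mi_pmc _)]/([:: _; _; _; _; _] ++ _) enc_seq_cat.
  congr (_ ++ (_ ++ _)).
  have out_cat5 a1 a2 a3 a4 a5 : out (a1 ++ a2 ++ a3 ++ a4 ++ a5) =
      out a1 ++ out a2 ++ out a3 ++ out a4 ++ out a5 by rewrite !out_cat.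
  have flat5 T (e : T -> seq letter) a1 a2 a3 a4 a5 :
      flatten (map e [:: a1; a2; a3; a4; a5]) = e a1 ++ e a2 ++ e a3 ++ e a4 ++ e a5.
    by rewrite /= cats0.
  have out_edge a1 a2 q w1 w2 : out a1 = w1 -> out a2 = w2 ->
      out (a1 ++ a2 ++ item_poly q) =
      w1 ++ w2 ++ enc_poly (map_code (@fresh_param m) q).
    by move=> <- <-; rewrite 2!out_cat out_poly.
  have num k : (k < 3)%N -> out (item_number k) = enc_nat (@new_state n (inord k)).
    by move=> k3; rewrite enew // out_num // ltnW.
  have init : out [:: Const Open; Copy 1] = enc_nat (@old_state n (code_init c)).
    by rewrite !out_cons hC (hG 0%N) // -[out [::]]/[::] cats0.
  rewrite out_cat5; apply: etrans _ (esym (flat5 _ _ _ _ _ _ _)).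
  have [num0 num1 num2] := And3 (num 0%N isT) (num 1%N isT) (num 2%N isT).
  rewrite (out_edge _ _ _ _ _ num0 init) (out_edge _ _ _ _ _ num0 num1).
  rewrite (out_edge _ _ _ _ _ num0 num2) (out_edge _ _ _ _ _ num1 num1).
  by rewrite (out_edge _ _ _ _ _ num2 num2).
- by rewrite out_param.
rewrite /items_region -[enc_formula _]/(enc_nat 3 ++ (enc_nat 3 ++ (enc_nat 0 ++ _) ++
   (enc_nat 1 ++ enc_poly _)) ++ enc_formula (map_formula (@old_param m) phi)).
rewrite 2!out_cat out_const; congr (_ ++ (_ ++ _)); last first.
  by rewrite out_cons hR enc_map_formula // -[out [::]]/[::] cats0.
rewrite 4!out_cat !out_const out_poly; congr (_ ++ (_ ++ (_ ++ _))).
have enc_seq2 T (e : T -> seq letter) a1 a2 :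
    enc_seq e [:: a1; a2] = [:: Open] ++ e a1 ++ e a2 ++ [:: Close].
  by rewrite /enc_seq /= cats0 -cats1 -catA.
apply: etrans _ (esym (enc_seq2 _ _ _ _)).
rewrite /items_threshold out_cons hC 3!out_cat out_seq out_term !out_cons !hC.
rewrite (hG 4%N) // (hG 5%N) // -[out [::]]/[::] cats0.
by congr (_ ++ (_ ++ (_ ++ _))).
Qed.

(** * Path measures *)

Fixpoint reach_within (R : realType) (n : nat) (Q : 'I_n.+1 -> 'I_n.+1 -> R)
    (T : {set 'I_n.+1}) (k : nat) (s : 'I_n.+1) : R :=
  if s \in T then 1 else
  if k is k'.+1 then \sum_s' Q s s' * reach_within Q T k' s' else 0.

Section PathMeasure.
Variables (R : realType) (n : nat) (Q : 'I_n.+1 -> 'I_n.+1 -> R).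
Local Notation state := 'I_n.+1.
Local Notation paths := (g_sigma_algebraType (@cylinders n)).

Lemma measurable_cylinder (h : seq state) :
  measurable (cylinder h : set paths).
Proof. by apply: sub_sigma_algebra; exists h. Qed.

Lemma cylinder_rcons (h : seq state) x w :
  cylinder (rcons h x) w <-> cylinder h w /\ w (size h) = x.
Proof.
rewrite /cylinder /= size_rcons /mkseq -[(size h).+1]addn1 iotaD map_cat cats1 /=.
rewrite add0n; split=> [/rcons_inj[-> ->] //|[-> ->]//].
Qed.

(** * Reachability as a limit of bounded reachability *)

Section Reach.
Variables (s : state) (mu : probability paths R) (T : {set state}).
Hypothesis muP : is_path_measure Q s mu.

(** The Markov property on cylinders. *)
Lemma path_measure_rcons h x y :
  mu (cylinder (rcons (rcons h x) y)) = (mu (cylinder (rcons h x)) * (Q x y)%:E)%E.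
Proof.
case: h => [|s0 h] /=; rewrite !muP /= -EFinM.
  by have [->|] := eqVneq x s; rewrite ?mul1r ?mul0r ?mulr1 ?mul1r.
rewrite -mulrA; congr (_ * _)%:E.
by elim: h s => [|z h IH] s' /=; rewrite ?mulr1 ?mul1r // IH mulrA.
Qed.

(** The induction on [k] lengthens the history [h] by the next state, which avoids shifting paths;
    the events for different next states are disjoint, so their measures add up. *)
Lemma path_measure_reach_within k h x :
  let B := cylinder (rcons h x) `&`
    [set w | exists2 j, (j <= k)%N & w (size h + j)%N \in T] in
  measurable (B : set paths) /\
  mu B = (mu (cylinder (rcons h x)) * (reach_within Q T k x)%:E)%E.
Proof.
elim: k h x => [|k IH] h x B.
  have [xT|xT] := boolP (x \in T).
    have -> : B = cylinder (rcons h x).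
      apply/seteqP; split=> [w []//|w cw]; split=> //; exists 0%N => //.
      by rewrite addn0; move/cylinder_rcons : cw => [_ ->].
    by split; [exact: measurable_cylinder|rewrite /= xT mule1].
  have -> : B = set0.
    apply/seteqP; split=> [w [/cylinder_rcons[_ wx] [[|//] _]]|//].
    by rewrite addn0 wx (negPf xT).
  by rewrite measure0 /= (negPf xT) mule0; split.
have [xT|xT] := boolP (x \in T).
  have -> : B = cylinder (rcons h x).
    apply/seteqP; split=> [w []//|w cw]; split=> //; exists 0%N => //.
    by rewrite addn0; move/cylinder_rcons : cw => [_ ->].
  by split; [exact: measurable_cylinder|rewrite /= xT mule1].
pose F y := cylinder (rcons (rcons h x) y) `&`
    [set w | exists2 j, (j <= k)%N & w (size (rcons h x) + j)%N \in T].
have mF y : measurable (F y : set paths) by case: (IH (rcons h x) y).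
have -> : B = \big[setU/set0]_(y in 'I_n.+1) F y.
  rewrite -bigcup_pred; apply/seteqP; split=> [w [cw [j]]|w [y _ [cw [j jk wT]]]].
    case: j => [|j jk wT].
      by rewrite addn0 ((cylinder_rcons h x w).1 cw).2 (negPf xT).
    exists (w (size h).+1) => //; split; last first.
      by exists j => //; rewrite size_rcons addSnnS.
    by apply/cylinder_rcons; rewrite size_rcons.
  split; first by case/cylinder_rcons : cw.
  by exists j.+1 => //; move: wT; rewrite size_rcons addSnnS.
split; first by apply: bigsetU_measurable.
rewrite measure_bigsetU_ord //; last first.
  apply/trivIsetP => y z _ _ yz; apply/seteqP; split=> // w [[+ _] [+ _]].
  by move=> /cylinder_rcons[_ wy] /cylinder_rcons[_ wz]; rewrite -wy -wz eqxx in yz.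
(* Cylinders have finite measure, so the sum can be computed in [R]. *)
have [c ce] : exists c, mu (cylinder (rcons h x)) = c%:E.
  by case: (h) => [|s0 h']; rewrite muP; eexists.
have muF y : mu (F y) = _ := (IH (rcons h x) y).2.
rewrite ce /= (negPf xT) -EFinM mulr_sumr -sumEFin; apply: eq_bigr => y _.
by apply: etrans (muF y) _; rewrite path_measure_rcons ce -!EFinM mulrA.
Qed.

(** Continuity from below: [visits T] is the increasing union of the events of visiting [T] within
    [k] steps. *)
Lemma path_measure_visits :
  exists2 r : R, mu (visits T) = r%:E & reach_within Q T ^~ s @ \oo --> r.
Proof.
pose F k x := cylinder [:: x] `&` [set w | exists2 j, (j <= k)%N & w j \in T].
have mF k x : measurable (F k x : set paths).
  exact: (path_measure_reach_within k [::] x).1.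
have muF k x : mu (F k x) = _ := (path_measure_reach_within k [::] x).2.
pose G k : set paths := [set w | exists2 j, (j <= k)%N & w j \in T].
have GF k : G k = \big[setU/set0]_(x in 'I_n.+1) F k x.
  rewrite -bigcup_pred; apply/seteqP; split=> [w Gw|w [x _ []]//].
  by exists (w 0%N).
have mG k : measurable (G k) by rewrite GF; exact: bigsetU_measurable.
have muG k : mu (G k) = (reach_within Q T k s)%:E.
  rewrite GF measure_bigsetU_ord //; last first.
    apply/trivIsetP => y z _ _ yz; apply/seteqP; split=> // w [[+ _] [+ _]].
    by rewrite /cylinder /= => -[wy] [wz]; rewrite -wy -wz eqxx in yz.
  rewrite (bigD1 s) //= big1 => [|x xs].
    by rewrite adde0; apply: etrans (muF k s) _; rewrite muP /= eqxx mul1r mul1e.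
  by apply: etrans (muF k x) _; rewrite muP /= (negPf xs) mul0r mul0e.
have visitsE : visits T = \bigcup_k G k.
  apply/seteqP; split=> [w [j wj]|w [k _ [j _ wj]]]; last by exists j.
  by exists j => //; exists j.
have mU : measurable (\bigcup_k G k) by exact: bigcupT_measurable.
have mur : mu (\bigcup_k G k) = (fine (mu (\bigcup_k G k)))%:E.
  by rewrite fineK // fin_num_measure.
rewrite visitsE; exists (fine (mu (\bigcup_k G k))) => //.
move: (fine _) mur => r mur.
have cG : nondecreasing_seq G -> mu \o G @ \oo --> r%:E.
  by rewrite -mur; exact: nondecreasing_cvg_mu mG mU.
rewrite (_ : reach_within Q T ^~ s = fine \o (mu \o G)).
  apply: fine_cvg; apply: cG => k l kl; apply/subsetPset => w [j jk wj].
  by exists j => //; exact: leq_trans kl.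
by apply/funext => k /=; rewrite muG.
Qed.
End Reach.

(** * Existence of the path measure *)

Hypothesis Qst : is_stochastic Q.

Let Q_ge0 s s' : 0 <= Q s s'. Proof. exact: (Qst s).1. Qed.

Definition cumul (s : state) (k : nat) : R := \sum_(j < n.+1 | (j < k)%N) Q s j.

Lemma cumulS s (i : state) : cumul s i.+1 = cumul s i + Q s i.
Proof.
rewrite /cumul (bigD1 i) //= addrC; congr (_ + _); apply: eq_bigl => j.
by rewrite ltnS andbC [RHS]ltn_neqAle.
Qed.

Lemma cumul0 s : cumul s 0 = 0. Proof. by rewrite /cumul big_pred0. Qed.

Lemma cumul1 s : cumul s n.+1 = 1.
Proof. by rewrite -(Qst s).2; apply: eq_bigl => j; rewrite ltn_ord. Qed.

Lemma cumul_le s k l : (k <= l)%N -> cumul s k <= cumul s l.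
Proof.
move=> kl; rewrite /cumul [leRHS](bigID (fun j : state => (j < k)%N)) /=.
rewrite ler_wpDr ?sumr_ge0 // le_eqVlt; apply/orP; left; apply/eqP.
by apply: eq_bigl => j; lia.
Qed.

(** The row of [s] cuts [0, 1[ into intervals of lengths [Q s i]; the default is used only for [y]
    outside [0, 1[. *)
Definition quantile (s : state) (y : R) : state :=
  odflt ord0 [pick i : state | cumul s i <= y < cumul s i.+1].

Lemma quantileP s y (i : state) : 0 <= y < 1 ->
  (quantile s y = i) <-> cumul s i <= y < cumul s i.+1.
Proof.
move=> /andP[y0 y1].
have uniq (j l : state) : cumul s j <= y < cumul s j.+1 ->
    cumul s l <= y < cumul s l.+1 -> j = l.
  wlog jl : j l / (j <= l)%N.
    move=> H hj hl; case/orP : (leq_total j l) => /H; first exact.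
    by move=> E; apply/esym/E.
  move=> /andP[_ j1] /andP[l1 _]; apply/val_inj/eqP; rewrite eqn_leq jl /=.
  rewrite leqNgt; apply/negP => /(cumul_le s) H.
  by have := lt_le_trans j1 (le_trans H l1); rewrite ltxx.
have ex : exists k, (k < n.+1)%N && (y < cumul s k.+1).
  by exists n; rewrite ltnSn cumul1.
rewrite /quantile; case: pickP => [j /= hj|none].
  by split=> [<- //|hi]; exact: uniq hj hi.
(* The least [k] with [y < cumul s k.+1] would be a valid choice: minimality gives the lower
   bound. *)
exfalso; case: (ex_minnP ex) => k /andP[kn yk] kmin.
have := none (Ordinal kn); rewrite /= yk andbT => /negP; apply.
case: k kn yk kmin => [|k] kn yk kmin; first by rewrite cumul0.
rewrite leNgt; apply/negP => yk'.
by have := kmin k; rewrite yk' (ltnW kn) ltnn => /(_ isT).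
Qed.

(** As in arithmetic coding, the interval containing [y] gives the next state, and [y] is rescaled
    from that interval to [0, 1[ for the rest of the path. *)
Fixpoint coded_path (s : state) (y : R) (k : nat) : state :=
  if k is k'.+1 then
    let s' := quantile s y in coded_path s' ((y - cumul s s') / Q s s') k'
  else s.

(** The interval of [s' :: h] from [s] is that of [h] from [s'], scaled by [Q s s'] and translated
    by [cumul s s']. *)
Lemma coded_path_itv h s : exists a : R,
  [/\ 0 <= a, a + path_weight Q s h <= 1 &
      forall y, 0 <= y < 1 -> cylinder (s :: h) (coded_path s y) <->
        a <= y < a + path_weight Q s h].
Proof.
have cylS s0 s1 h0 (w : nat -> state) : cylinder [:: s0, s1 & h0] w <->
    w 0%N = s0 /\ cylinder (s1 :: h0) (fun k => w k.+1).
  rewrite /cylinder /mkseq /= -[iota 2 _](map_id) (iotaDl 1 1) (iotaDl 1 0).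
  rewrite -!map_comp /=.
  by split=> [[-> <- ->]|[-> [<- ->]]].
elim: h s => [|s' h IH] s /=.
  by exists 0; split=> [||y]; rewrite ?add0r.
have [a [a0 a1 ha]] := IH s'; set W := path_weight Q s' h in a1 ha *.
have c1 : cumul s s' + Q s s' <= 1 by rewrite -cumulS -(cumul1 s) cumul_le.
have c0 : 0 <= cumul s s' by rewrite -(cumul0 s) cumul_le.
have q0 := Q_ge0 s s'.
exists (cumul s s' + Q s s' * a); split.
- by rewrite addr_ge0 // mulr_ge0.
- by rewrite -addrA -mulrDr; apply: le_trans c1; rewrite lerD2l ler_piMr.
move=> y y01; rewrite cylS /=; split.
  move=> [_ cy].
  have e : quantile s y = s' by move: cy; rewrite /cylinder /= => -[].
  have := (quantileP _ _ y01).1 e; rewrite cumulS => /andP[yl yr]; rewrite e in cy.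
  (* The interval of [s'] contains [y], so it has positive length and the rescaling is a genuine
     division. *)
  have qp : 0 < Q s s' by lra.
  have /ha[+ _] : 0 <= (y - cumul s s') / Q s s' < 1.
    by rewrite ler_pdivlMr // ltr_pdivrMr // mul0r mul1r; apply/andP; split; lra.
  move=> /(_ cy); rewrite ler_pdivlMr // ltr_pdivrMr // => /andP[? ?].
  by apply/andP; split; lra.
move=> /andP[yl yr].
have qp : 0 < Q s s'.
  by rewrite lt_def q0 andbT; apply/eqP => E; move: yl yr; rewrite E !mul0r; lra.
have Qa0 : 0 <= Q s s' * a by rewrite mulr_ge0.
have QaW : Q s s' * (a + W) <= Q s s' by rewrite ler_piMr.
have e : quantile s y = s'.
  by apply/quantileP => //; rewrite cumulS; apply/andP; split; lra.
split=> //; rewrite e; apply/ha;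
  by rewrite ler_pdivlMr // ltr_pdivrMr //; apply/andP; split; lra.
Qed.

(** Constant paths outside [0, 1[ keep the map measurable on the whole line, and all its paths start
    in [s]. *)
Definition unit_coded_path (s : state) (y : measurableTypeR R) : paths :=
  if (y : R) \in `[0, 1[%R then coded_path s y else (fun=> s).

Lemma unit_coded_path0 s y : unit_coded_path s y 0%N = s.
Proof. by rewrite /unit_coded_path; case: ifP. Qed.

Lemma preimage_unit_coded_path s h : exists a : R,
  [/\ 0 <= a, a + path_weight Q s h <= 1 &
      unit_coded_path s @^-1` cylinder (s :: h) `&` `[0, 1[ =
      `[a, a + path_weight Q s h[].
Proof.
have [a [a0 a1 ha]] := coded_path_itv h s; exists a; split=> //.
apply/seteqP; split=> y /=.
  rewrite /unit_coded_path => -[+ y01]; rewrite y01 => /ha.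
  by rewrite !in_itv /= in y01 *; exact.
move=> yI; have y01 : y \in `[0, 1[%R.
  by move: yI; rewrite !in_itv /= => /andP[? ?]; apply/andP; split; lra.
split=> //; rewrite /unit_coded_path y01; apply/ha.
  by rewrite in_itv in y01.
by rewrite in_itv in yI.
Qed.

(** It suffices to look at preimages of cylinders. Inside [0, 1[ such a preimage is an interval or
    empty; outside it is everything or nothing. *)
Lemma measurable_unit_coded_path s : 
  measurable_fun [set: measurableTypeR R] (unit_coded_path s).
Proof.
refine (@measurability _ _ _ paths _ _ (@cylinders n) erefl _) => _ [_ [h _ <-] <-].
rewrite setTI.
rewrite -(setIT (_ @^-1` _)) -(setUv (`[0, 1[ : set R)) setIUr.
apply: measurableU.
  case: h => [|s0 h].
    rewrite (_ : cylinder [::] = setT) ?preimage_setT ?setTI //.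
    by apply/seteqP; split.
  have [->|ss0] := eqVneq s0 s.
    by have [a [_ _ ->]] := preimage_unit_coded_path s h.
  rewrite (_ : _ `&` _ = set0) //; apply/seteqP; split=> // y [/(congr1 (head s)) E _].
  have /eqP := etrans (esym (unit_coded_path0 s y)) E.
  by rewrite eq_sym (negPf ss0).
have [hs|hs] := pselect (cylinder h (fun=> s)).
  rewrite (_ : _ `&` _ = ~` `[0, 1[); first exact: measurableC.
  apply/seteqP; split=> [y []//|y ny]; split=> //.
  by rewrite /= /unit_coded_path; case: ifP.
rewrite (_ : _ `&` _ = set0) //; apply/seteqP; split=> // y [+ ny].
by rewrite /= /unit_coded_path; case: ifP.
Qed.

HB.instance Definition _ s := isMeasurableFun.Build _ _ _ _
  (unit_coded_path s) (measurable_unit_coded_path s).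

Definition unit_lebesgue : set (measurableTypeR R) -> \bar R :=
  mrestr (@lebesgue_measure R) (measurable_itv `[0, 1[%R).

HB.instance Definition _ := Measure.on unit_lebesgue.

Lemma unit_lebesgueT : unit_lebesgue setT = 1%E.
Proof.
by rewrite /unit_lebesgue /mrestr setTI lebesgue_measure_itv /= lte01 oppr0 adde0.
Qed.

HB.instance Definition _ :=
  Measure_isProbability.Build _ _ _ unit_lebesgue unit_lebesgueT.

Lemma path_measure_exists s :
  exists mu : probability paths R, is_path_measure Q s mu.
Proof.
exists (distribution unit_lebesgue (unit_coded_path s)) => s0 h.
rewrite /distribution /pushforward /unit_lebesgue /mrestr.
have [->|ss0] := eqVneq s0 s.
  have [a [a0 a1 E]] := preimage_unit_coded_path s h.
  apply: etrans (congr1 (@lebesgue_measure R) E) _.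
  rewrite lebesgue_measure_itv /= lte_fin ltrDl mul1r -EFinB addrC addKr.
  (* If the interval is empty, the weight is at most 0; being nonnegative, it is 0. *)
  case: ltP => // W0; congr EFin; apply/eqP; rewrite eq_le W0 andbT.
  by elim: (h) (s) => //= s' h' IH s1; rewrite mulr_ge0.
rewrite mul0r; apply: etrans (measure0 (@lebesgue_measure R)).
congr lebesgue_measure; apply/seteqP; split=> // y [/(congr1 (head s)) E _].
have /eqP := etrans (esym (unit_coded_path0 s y)) E.
by rewrite eq_sym (negPf ss0).
Qed.

(** Every path measure gives [visits T] this same limit, so the choice made by [xget] does not
    matter; existence excludes its default value. *)
Lemma reach_prob_cvg T s : reach_within Q T ^~ s @ \oo --> reach_prob Q T s.
Proof.
rewrite /reach_prob; case: xgetP => [r _ [mu [muP mur]]|none].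
  by have [r' mur'] := path_measure_visits T muP; move: mur'; rewrite mur => -[->].
have [mu muP] := path_measure_exists s.
by have [r mur _] := path_measure_visits T muP; case: (none r); exists mu.
Qed.

End PathMeasure.

(** * Correctness of the reduction *)

Lemma mmap_poly_of_code (S : comNzRingType) (g : {rmorphism rat -> S}) (m : nat)
    (h : 'I_m -> S) (c : poly_code m) :
  mpoly.mmap g h (poly_of_code c) =
  \sum_(t <- c) g t.1 * \prod_(x <- t.2) h x.1 ^+ x.2.
Proof.
rewrite /poly_of_code raddf_sum /=; apply: eq_bigr => t _.
rewrite mpoly.mmapZ; congr (_ * _).
rewrite rmorph_prod; apply: eq_bigr => x _.
by rewrite rmorphXn /= mpoly.mmapX mpoly.mmap1U.
Qed.

Lemma poly_eval_code (R : realType) m (u : instantiation R m) c :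
  poly_eval u (poly_of_code c) =
  \sum_(t <- c) ratr t.1 * \prod_(x <- t.2) u x.1 ^+ x.2.
Proof. exact: mmap_poly_of_code. Qed.

(** Shows renaming to be a substitution, hence additive on polynomials. *)
Lemma poly_of_map_code m m' (f : 'I_m -> 'I_m') c :
  poly_of_code (map_code f c) =
  mpoly.mmap (@mpoly.mpolyC m' rat) (fun i => mpoly.mpolyX rat (mpoly.mnm1 (f i)))
    (poly_of_code c).
Proof.
rewrite mmap_poly_of_code /poly_of_code big_map; apply: eq_bigr => t _ /=.
by rewrite mpoly.mul_mpolyC big_map.
Qed.

Lemma poly_eval_map_code (R : realType) m m' (f : 'I_m -> 'I_m')
    (u : instantiation R m') c :
  poly_eval u (poly_of_code (map_code f c)) = poly_eval (u \o f) (poly_of_code c).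
Proof.
rewrite !poly_eval_code big_map; apply: eq_bigr => t _ /=.
by rewrite big_map.
Qed.

Lemma region_map_formula (R : realType) m m' (f : 'I_m -> 'I_m') phi
    (u : instantiation R m') :
  region R (map_formula f phi) u <-> region R phi (u \o f).
Proof.
elim: phi => [c|c|p1 IH1|p1 IH1 p2 IH2|p1 IH1 p2 IH2] /=;
  rewrite ?poly_eval_map_code //.
- by rewrite /setC /=; tauto.
- by rewrite /setI /=; tauto.
- by rewrite /setU /=; tauto.
Qed.

(** * Transitions and solution function of the reduced chain *)

Section ReductionCorrect.
Variables (R : realType) (n m : nat) (c : pMC_code n m).
Local Notation new k := (@new_state n (inord k)).
Local Notation old := (@old_state n).
Local Notation M := (pMC_of_code c).
Local Notation M' := (pMC_of_code (red_pMC c)).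

Lemma sum_states (F : 'I_(n + 3).+1 -> R) :
  \sum_s F s = \sum_s F (old s) + (F (new 0) + F (new 1) + F (new 2)).
Proof.
rewrite [LHS](@big_split_ord _ _ _ n.+1 3) /=; congr (_ + _).
rewrite !big_ord_recr big_ord0 /= add0r.
by congr (F _ + F _ + F _); apply/val_inj; rewrite /= inordK.
Qed.

Lemma stateP (s : 'I_(n + 3).+1) :
  (exists s0, s = old s0) \/ exists2 k, (k < 3)%N & s = new k.
Proof.
case: (@split_ordP n.+1 3 s) => [s0 ->|i ->]; first by left; exists s0.
by right; exists i => //; rewrite /new_state inord_val.
Qed.

Lemma eq_old s1 s2 : (old s1 == old s2) = (s1 == s2).
Proof. exact: (inj_eq (@lshift_inj _ _)). Qed.

Lemma eq_new k l : (k < 3)%N -> (l < 3)%N -> (new k == new l) = (k == l).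
Proof.
by move=> k3 l3; rewrite -val_eqE /= eqn_add2l !inordK.
Qed.

Lemma eq_old_new s k : (old s == new k) = false.
Proof. exact: eq_lrshift. Qed.

Lemma eq_new_old s k : (new k == old s) = false.
Proof. by rewrite eq_sym eq_old_new. Qed.

Let eqE := (xpair_eqE, eq_old, eq_new_old, eq_old_new, eq_new, andbF, andbT).

Lemma red_trans_old s s' : pmc_trans M' (old s) (old s') =
  \sum_(e <- code_trans c | e.1 == (s, s')) poly_of_code (map_code (@old_param m) e.2).
Proof.
rewrite /= !big_cons !eqE /= big_map; apply: eq_bigl => e /=.
by rewrite !eqE; case: e => -[].
Qed.

(** Graph preservation tests polynomials, and repeated entries may cancel, so the whole sum is
    renamed at once. *)
Lemma red_trans_old_eq0 s s' :
  pmc_trans M s s' = 0 -> pmc_trans M' (old s) (old s') = 0.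
Proof.
rewrite red_trans_old => z; under eq_bigr do rewrite poly_of_map_code.
apply: etrans (esym (raddf_sum _ _ _ _)) _.
by rewrite [X in _ X = 0](_ : _ = 0) ?raddf0 //; exact: z.
Qed.

Lemma red_trans_old_new s k : pmc_trans M' (old s) (new k) = 0.
Proof.
rewrite /= !big_cons !xpair_eqE !eq_new_old /= big_map big_pred0 // => e /=.
by rewrite !eqE.
Qed.

Lemma red_trans_new_old k s : (k < 3)%N -> pmc_trans M' (new k) (old s) =
  if (k == 0%N) && (s == code_init c)
  then poly_of_code (map_code (@fresh_param m) code_enter) else 0.
Proof.
move=> k3; rewrite /= !big_cons big_map big_pred0; last by move=> e; rewrite /= !eqE.
rewrite !eqE // [_ == k]eq_sym [code_init _ == _]eq_sym.
by case: ifP; rewrite ?addr0.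
Qed.

Lemma red_trans_new k l : (k < 3)%N -> (l < 3)%N -> pmc_trans M' (new k) (new l) =
  if (k, l) == (0, 1)%N then poly_of_code (map_code (@fresh_param m) code_accept)
  else if (k, l) == (0, 2)%N then poly_of_code (map_code (@fresh_param m) code_reject)
  else if (k == l) && (k != 0)%N then poly_of_code (map_code (@fresh_param m) code_one)
  else 0.
Proof.
move=> k3 l3; rewrite /= !big_cons big_map big_pred0; last by move=> e; rewrite /= !eqE.
rewrite !eqE //.
by case: k k3 => [|[|[|]]] //; case: l l3 => [|[|[|]]] // _ _; rewrite /= ?addr0 ?add0r.
Qed.

Variables (u : instantiation R (red_params m)).
Local Notation p := (u (slope_param m)).
Local Notation x := (u (threshold_param m)).
Local Notation v := (u \o @old_param m).

Let ratrE := (rmorph1, rmorphN1, fmorphV, rmorph_nat, rmorphN).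

Lemma eval_one : poly_eval u (poly_of_code (map_code (@fresh_param m) code_one)) = 1.
Proof.
by rewrite poly_eval_map_code poly_eval_code big_seq1 big_nil /= !ratrE mulr1.
Qed.

Lemma eval_enter :
  poly_eval u (poly_of_code (map_code (@fresh_param m) code_enter)) = p.
Proof.
by rewrite poly_eval_map_code poly_eval_code big_seq1 big_seq1 /= !ratrE mul1r expr1.
Qed.

Lemma eval_accept :
  poly_eval u (poly_of_code (map_code (@fresh_param m) code_accept)) = 2^-1 - p * x.
Proof.
rewrite poly_eval_map_code poly_eval_code !big_cons !big_nil /= !ratrE.
by rewrite /fresh_param /=; ring.
Qed.

Lemma eval_reject :
  poly_eval u (poly_of_code (map_code (@fresh_param m) code_reject)) =
  2^-1 - p + p * x.
Proof.
rewrite poly_eval_map_code poly_eval_code !big_cons !big_nil /= !ratrE.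
by rewrite /fresh_param /=; ring.
Qed.

Lemma eval_range :
  poly_eval u (poly_of_code (map_code (@fresh_param m) code_range)) = p * (1 - 4 * p).
Proof.
rewrite poly_eval_map_code poly_eval_code !big_cons !big_nil /= !ratrE.
by rewrite /fresh_param /=; ring.
Qed.

Lemma eval_threshold lambda :
  poly_eval u (poly_of_code (map_code (@fresh_param m) (code_threshold lambda))) =
  ratr lambda - x.
Proof.
rewrite poly_eval_map_code poly_eval_code !big_cons !big_nil /= !ratrE.
by rewrite /fresh_param /=; ring.
Qed.

Lemma poly_eval0 m0 (w : instantiation R m0) : poly_eval w 0 = 0.
Proof. exact: raddf0. Qed.

Lemma red_inst_old s s' : instantiate M' u (old s) (old s') = instantiate M v s s'.
Proof.
rewrite /instantiate red_trans_old /= /poly_eval !raddf_sum /=.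
by apply: eq_bigr => e _; exact: poly_eval_map_code.
Qed.

Lemma red_inst_old_new s k : instantiate M' u (old s) (new k) = 0.
Proof. by rewrite /instantiate red_trans_old_new poly_eval0. Qed.

Lemma red_inst_new_old k s : (k < 3)%N ->
  instantiate M' u (new k) (old s) = if (k == 0%N) && (s == code_init c) then p else 0.
Proof.
by move=> k3; rewrite /instantiate red_trans_new_old //; case: ifP;
  rewrite ?eval_enter ?poly_eval0.
Qed.

Lemma red_inst_new k l : (k < 3)%N -> (l < 3)%N -> instantiate M' u (new k) (new l) =
  if (k, l) == (0, 1)%N then 2^-1 - p * x
  else if (k, l) == (0, 2)%N then 2^-1 - p + p * x
  else if (k == l) && (k != 0)%N then 1 else 0.
Proof.
move=> k3 l3; rewrite /instantiate red_trans_new //.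
case: ifP => _; first by rewrite eval_accept.
case: ifP => _; first by rewrite eval_reject.
by case: ifP => _; rewrite ?eval_one ?poly_eval0.
Qed.

Hypotheses (p_gt0 : 0 < p) (p_lt : p < 4^-1) (x_ge0 : 0 <= x) (x_le1 : x <= 1).
Hypothesis gpM : graph_preserving M v.

Lemma red_graph_preserving : graph_preserving M' u.
Proof.
(* These bounds make both [1/2 - p * x] and [1/2 - p + p * x] positive. *)
have [h1 h2 h3] : [/\ 0 <= p * x, p * x <= p & 4 * p < 1].
  split; first by rewrite mulr_ge0 // ltW.
    by rewrite ler_piMr // ltW.
  by move: p_lt; rewrite -[4^-1]mul1r ltr_pdivlMr // mulrC.
split=> [s|s s'].
  split=> [s'|].
    have [[s0 ->]|[k k3 ->]] := stateP s; have [[s1 ->]|[l l3 ->]] := stateP s'.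
    - by rewrite red_inst_old; exact: (gpM.1 s0).1.
    - by rewrite red_inst_old_new.
    - by rewrite red_inst_new_old //; case: ifP => // _; exact: ltW.
    - rewrite red_inst_new //; case: ifP => _; first by lra.
      by case: ifP => _; [lra|case: ifP].
  have [[s0 ->]|[k k3 ->]] := stateP s; rewrite sum_states.
    rewrite !red_inst_old_new !addr0; under eq_bigr do rewrite red_inst_old.
    exact: (gpM.1 s0).2.
  rewrite !red_inst_new //; under eq_bigr do rewrite (red_inst_new_old _ k3).
  case: k k3 => [|[|[|]]] //= _; last 2 first.
  - by rewrite big1 // !add0r ?addr0.
  - by rewrite big1 // !add0r ?addr0.
  by rewrite -big_mkcond big_pred1_eq; lra.
have [[s0 ->]|[k k3 ->]] := stateP s; have [[s1 ->]|[l l3 ->]] := stateP s'.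
- rewrite red_inst_old => nz; apply: gpM.2; apply: contraNN nz => /eqP z.
  exact/eqP/red_trans_old_eq0.
- by rewrite red_trans_old_new eqxx.
- rewrite red_trans_new_old // red_inst_new_old //.
  by case: ifP => _; rewrite ?eqxx // => _; rewrite gt_eqF.
rewrite red_trans_new // red_inst_new //.
case: ifP => [_ _|_]; first by rewrite gt_eqF //; lra.
case: ifP => [_ _|_]; first by rewrite gt_eqF //; lra.
by case: ifP => _; rewrite ?oner_eq0 ?eqxx.
Qed.

Let tgtE : pmc_target M' = [set s in new 1 :: map old (code_target c)]%SET.
Proof. by []. Qed.

Lemma red_target_old s : (old s \in pmc_target M') = (s \in pmc_target M).
Proof.
rewrite tgtE !inE eq_old_new /= mem_map //; exact: lshift_inj.
Qed.

Lemma red_target_new k : (k < 3)%N -> (new k \in pmc_target M') = (k == 1%N).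
Proof.
move=> k3; rewrite tgtE !inE eq_new //; case: eqP => //= _.
by apply/mapP => -[s _ /eqP]; rewrite eq_new_old.
Qed.

Local Notation reach' := (reach_within (instantiate M' u) (pmc_target M')).
Local Notation reach := (reach_within (instantiate M v) (pmc_target M)).

Lemma red_reach_old k s : reach' k (old s) = reach k s.
Proof.
elim: k s => [|k IH] s /=; rewrite red_target_old //; case: ifP => // _.
rewrite sum_states !red_inst_old_new !mul0r !addr0.
by apply: eq_bigr => s' _; rewrite red_inst_old IH.
Qed.

Lemma red_reach_accept k : reach' k (new 1) = 1.
Proof. by case: k => [|k] /=; rewrite red_target_new. Qed.

Lemma red_reach_reject k : reach' k (new 2) = 0.
Proof.
elim: k => [|k IH] /=; rewrite red_target_new //= sum_states !red_inst_new //= IH.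
rewrite big1 => [|s _]; last by rewrite red_inst_new_old //= mul0r.
by rewrite !mul0r mulr0 !addr0.
Qed.

Lemma red_reach_init k :
  reach' k.+1 (new 0) = p * reach k (code_init c) + (2^-1 - p * x).
Proof.
rewrite /= red_target_new //= sum_states !red_inst_new //=.
rewrite red_reach_accept red_reach_reject mul0r mulr1 mulr0 add0r addr0.
congr (_ + _).
under eq_bigr do rewrite (red_inst_new_old _ (isT : (0 < 3)%N)) red_reach_old.
rewrite (bigD1 (code_init c)) //= eqxx big1 ?addr0 // => s si.
by rewrite (negPf si) mul0r.
Qed.

Lemma red_sol : sol M' (pmc_init M') u = p * sol M (pmc_init M) v + (2^-1 - p * x).
Proof.
have c1 := @reach_prob_cvg _ _ _ red_graph_preserving.1 (pmc_target M') (new 0).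
have c2 := @reach_prob_cvg _ _ _ gpM.1 (pmc_target M) (code_init c).
set l := (X in _ = X).
have c3 : reach' k.+1 (new 0) @[k --> \oo] --> l.
  under eq_fun do rewrite red_reach_init.
  by apply: cvgD; [exact: cvgM (cvg_cst _) c2|exact: cvg_cst].
(* [red_reach_init] spends one step on leaving the new initial state, so the limit is taken along
   [k.+1] and shifted back. *)
have E := cvg_shiftS (reach' ^~ (new 0)) (nbhs l).
have c4 : reach' ^~ (new 0) @ \oo --> nbhs l by rewrite -E; exact: c3.
exact: (cvg_unique (@Rhausdorff R) c1 c4).
Qed.

End ReductionCorrect.

(** * Equivalence of the two decision problems *)

Section Correctness.
Variables (R : realType) (y : verification_instance).
Local Notation m := (vi_params y).
Local Notation M := (pMC_of_code (vi_pmc y)).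
Local Notation M' := (pMC_of_code (mi_pmc (reduction y))).
Local Notation lambda := (ratr (vi_threshold y) : R).

Lemma red_regionP (u : instantiation R (red_params m)) :
  region R (mi_region (reduction y)) u <->
  [/\ 0 < u (slope_param m), u (slope_param m) < 4^-1,
      u (threshold_param m) = lambda & region R (vi_region y) (u \o @old_param m)].
Proof.
rewrite /= /setI /= region_map_formula eval_range eval_threshold.
set p := u _; have pE : 0 < p * (1 - 4 * p) <-> 0 < p /\ p < 4^-1.
  split=> [h|[p0 p4]]; last by nra.
  by split; nra.
rewrite pE; split=> [[[[-> ->] /eqP]]|[-> -> -> h]].
  by rewrite subr_eq0 => /eqP ->.
by rewrite subrr.
Qed.

Hypothesis promise : verification_promise R y.

Let lambda01 : 0 <= lambda <= 1.
Proof.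
have /andP[l0 l1] := promise.1.
by rewrite ler0q l0 -(rmorph1 (@ratr R)) ler_rat.
Qed.

Lemma red_region_gp u : region R (mi_region (reduction y)) u ->
  graph_preserving M' u /\
  sol M' (pmc_init M') u =
    u (slope_param m) * sol M (pmc_init M) (u \o @old_param m) +
    (2^-1 - u (slope_param m) * lambda).
Proof.
move=> /red_regionP[p0 p4 xE hv]; have /andP[l0 l1] := lambda01.
rewrite -xE in l0 l1 *; have gp := promise.2 _ hv.
by split; [exact: red_graph_preserving|exact: red_sol].
Qed.

Lemma reduction_promise : monotonicity_promise R (reduction y).
Proof. by move=> u /red_region_gp[]. Qed.

Lemma inst_shift_slope (u : instantiation R (red_params m)) b :
  [/\ inst_shift u (slope_param m) b (slope_param m) = u (slope_param m) + b,
      inst_shift u (slope_param m) b (threshold_param m) = u (threshold_param m) &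
      inst_shift u (slope_param m) b \o @old_param m = u \o @old_param m].
Proof.
split; rewrite /inst_shift ?eqxx ?mulr1 //.
  by rewrite -val_eqE /= (_ : (m == m.*2.+1) = false) ?mulr0 ?addr0 //; lia.
apply/funext => i /=; rewrite -val_eqE /=.
by rewrite (_ : (i == m.*2.+1 :> nat) = false) ?mulr0 ?addr0 //; have := ltn_ord i; lia.
Qed.

(** Raising the slope by [b] leaves the old parameters alone and changes the new solution by
    [b * (sol - lambda)]. *)
Lemma reduction_holds :
  monotonicity_holds R (reduction y) <-> verification_holds R y.
Proof.
split=> [mono N u0 hu0|ver u b hu b0 hu'].
  (* The slope 1/16 and its shift by 1/16 both lie in ]0, 1/4[. *)
  pose u : instantiation R (red_params m) := fun j =>
    if insub (val j) is Some i then u0 i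
    else if j == slope_param m then 16^-1 else lambda.
  have uold : u \o @old_param m = u0.
    by apply/funext => i; rewrite /u /= (valK i).
  have uslope : u (slope_param m) = 16^-1.
    by rewrite /u insubN ?eqxx //= -leqNgt; lia.
  have uthr : u (threshold_param m) = lambda.
    by rewrite /u insubN ?ltnn // ifF // -val_eqE /=; lia.
  have hu : region R (mi_region (reduction y)) u.
    by apply/red_regionP; rewrite uold uslope uthr; split=> //; lra.
  have [s1 s2 s3] := inst_shift_slope u 16^-1.
  have hu' : region R (mi_region (reduction y)) (inst_shift u (slope_param m) 16^-1).
    by apply/red_regionP; rewrite s1 s2 s3 uold uslope uthr; split=> //; lra.
  have := mono u 16^-1 hu _ hu'.
  rewrite (red_region_gp hu).2 (red_region_gp hu').2 s1 s3 uold uslope.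
  set S := sol _ _ _; move=> h; rewrite -/S in h *.
  by have := h _; lra.
have [s1 s2 s3] := inst_shift_slope u b.
rewrite (red_region_gp hu).2 (red_region_gp hu').2 s1 s3.
have /red_regionP[_ _ _ /ver] := hu; move: (sol _ _ _) => S lS.
have : 0 <= b * (S - lambda) by rewrite mulr_ge0 // subr_ge0.
by lra.
Qed.

End Correctness.

Theorem theorem1 (R : realType) :
  polytime_reducible (verification_problem R) (monotonicity_problem R).
Proof.
exists (fun w => flatten (map (scan_output w) reduction_items)); split.
- exact: items_polytime.
- move=> _ [y [-> promise holds]]; exists (reduction y).
  split; [exact: reduction_items_correct|exact: reduction_promise|].
  exact/reduction_holds.
move=> _ [y [-> promise fails]]; exists (reduction y).
split; [exact: reduction_items_correct|exact: reduction_promise|].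
by move=> /(reduction_holds promise)/fails.
Qed.
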